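(* Let $\alpha:\mathbb{R}\to\mathbb{R}$ be a locally Lipschitz extended class $\mathcal{K}$ function, let $\varepsilon>0$, and for $m\in[2:n]$ let $$\mathcal{U}_{[2:m]}(\mathbf{x}) := \{\mathbf{u}\in\mathbb{R}^N \mid \mu_{[2:m]}(\mathbf{x},\mathbf{u})\ge -\alpha(\lambda_m(\mathbf{x})-\varepsilon)\}.$$ Define the constraint map $$\mathcal{U}_{\mathrm{agg}}(\mathbf{x}) := \bigcap_{m\in[2:n]}\mathcal{U}_{[2:m]}(\mathbf{x}).$$ Assume that $J$ and $g_{\mathrm{nom}}$ are continuous, that $J$ is strictly convex in $\mathbf{u}$, and that $g_{\mathrm{nom}}$ is convex in $\mathbf{u}$. Suppose that, for each $\mathbf{x}$, there exists a control input $\mathbf{u}\in\mathbb{R}^N$ that strictly satisfies the constraint map $\mathcal{U}_{\mathrm{agg}}\cap\mathcal{U}_{\mathrm{nom}}(\mathbf{x})$, i.e., $\mu_{[2:m]}(\mathbf{x},\mathbf{u})>-\alpha(\lambda_m(\mathbf{x})-\varepsilon)$ for all $m\in[2:n]$ and $g_{\mathrm{nom}}(\mathbf{x},\mathbf{u})<0$ (componentwise). Then the optimization-based controller $$\mathbf{k}_{\mathrm{agg}}(\mathbf{x}) := \underset{\mathbf{u}\in\mathcal{U}_{\mathrm{agg}}(\mathbf{x})\cap\mathcal{U}_{\mathrm{nom}}(\mathbf{x})}{\arg\min}\ J(\mathbf{x},\mathbf{u})$$ is continuous on $\mathcal{C}_\varepsilon=\{\mathbf{x}\in\mathbb{R}^N\mid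 \lambda_2(\mathbf{x})\ge\varepsilon\}$. In addition, for any initial condition $\mathbf{x}_0\in\mathcal{C}_\varepsilon$, along the Carathéodory solutions $t\mapsto\mathbf{x}(t)$ of the closed-loop system $\dot{\mathbf{x}}=\mathbf{k}_{\mathrm{agg}}(\mathbf{x})$ with $\mathbf{x}(0)=\mathbf{x}_0$ one has $\lambda_2(\mathbf{x}(t))\ge\varepsilon$ at all times (so that network connectivity is maintained).
   Context: Multi-robot system: $n$ robots with dynamics $\dot x_r=u_r$, $x_r,u_r\in\mathbb{R}^{d_r}$, $r\in[n]=\{1,\dots,n\}$; $N=\sum_r d_r$, $\mathbf{x}=[x_1^\top,\dots,x_n^\top]^\top\in\mathbb{R}^N$, $\mathbf{u}=[u_1^\top,\dots,u_n^\top]^\top\in\mathbb{R}^N$, so $\dot{\mathbf{x}}=\mathbf{u}$. Write $[m:n]=\{m,\dots,n\}$. The interaction topology is a state-dependent undirected weighted graph on vertex set $[n]$ with symmetric, entrywise nonnegative adjacency matrix $\mathbf{A}(\mathbf{x})\in\mathbb{R}^{n\times n}$, where $\mathbf{x}\mapsto\mathbf{A}(\mathbf{x})$ is continuously differentiable; $\mathbf{A}_{ij}(\mathbf{x})>0$ iff $(i,j)$ is an edge. The Laplacian is $\mathbf{L}(\mathbf{x})=\mathbf{D}(\mathbf{x})-\mathbf{A}(\mathbf{x})$, with $\mathbf{D}$ diagonal and $\mathbf{D}_{ii}=\sum_j\mathbf{A}_{ij}$. Its eigenvalues are $0=\lambda_1(\mathbf{x})\le\lambda_2(\mathbf{x})\le\dots\le\lambda_n(\mathbf{x})$,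 counted with multiplicity; the graph is connected iff $\lambda_2(\mathbf{x})>0$. Let $\mathbb{S}^n$ denote the unit sphere in $\mathbb{R}^n$ (the set of $\mathbf{v}\in\mathbb{R}^n$ with $\|\mathbf{v}\|=1$). For $p\in[n]$, $\mathcal{V}_p(\mathbf{x})=\{\mathbf{v}\in\mathbb{S}^n\mid \mathbf{L}(\mathbf{x})\mathbf{v}=\lambda_p(\mathbf{x})\mathbf{v}\}$. For $\mathcal{I}\subseteq[n]$ nonempty, $\mathcal{V}_{\mathcal{I}}(\mathbf{x})=\mathrm{span}\{\bigcup_{p\in\mathcal{I}}\mathcal{V}_p(\mathbf{x})\}\cap\mathbb{S}^n$ and $$\mu_{\mathcal{I}}(\mathbf{x},\mathbf{u})=\min_{\mathbf{v}\in\mathcal{V}_{\mathcal{I}}(\mathbf{x})}\mathbf{v}^\top\Big(\sum_{i\in[N]}\frac{\partial\mathbf{L}}{\partial\mathbf{x}_i}(\mathbf{x})\,\mathbf{u}_i\Big)\mathbf{v},$$ where $\mathbf{x}_i,\mathbf{u}_i$ are the scalar components of $\mathbf{x},\mathbf{u}$. The cost function is $J:\mathbb{R}^N\times\mathbb{R}^N\to\mathbb{R}$, and the nominal constraint map is $\mathcal{U}_{\mathrm{nom}}(\mathbf{x})=\{\mathbf{u}\in\mathbb{R}^N\mid g_{\mathrm{nom}}(\mathbf{x},\mathbf{u})\le0\}$ (componentwise) with $g_{\mathrm{nom}}:\mathbb{R}^N\times\mathbb{R}^N\to\mathbb{R}^{d_{\mathrm{nom}}}$. Intersections of set-valued maps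 are pointwise. An extended class $\mathcal{K}$ function is a continuous strictly increasing $\alpha:\mathbb{R}\to\mathbb{R}$ with $\alpha(0)=0$. A Carathéodory solution is an absolutely continuous trajectory satisfying the dynamics at almost every time.
   Formalization: The minimum defining k_agg(x) is assumed to be attained at every x; the stated hypotheses do not ensure this (J = sum of exp(u_i), constant A with lambda_2 > epsilon, g_nom = -1 has an empty argmin). *)

(* Defs.v *)
From HB Require Import structures.
From mathcomp Require Export all_boot all_order all_algebra.
From mathcomp Require Export all_classical all_reals all_analysis.
Export numFieldNormedType.Exports.

Set Implicit Arguments.
Unset Strict Implicit.
Unset Printing Implicit Defensive.
Import Order.TTheory GRing.Theory Num.Theory.

Local Open Scope classical_set_scope.
Local Open Scope ring_scope.

Definition graph_connected (R : realType) (n : nat) (A : 'M[R]_n) : Prop :=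
  forall i j, connect [rel i' j' | 0 < A i' j'] i j.

Definition laplacian (R : realType) (n : nat) (A : 'M[R]_n) : 'M[R]_n :=
  diag_mx (\row_i \sum_j A i j) - A.

(* The sequence is unique when it exists (i.e. when the characteristic
   polynomial splits over R, in particular for symmetric M); the default value
   [::] is only used otherwise. *)
Definition eigenvalues (R : realType) (n : nat) (M : 'M[R]_n) : seq R :=
  xget [::] [set s | sorted <=%R s /\ char_poly M = \prod_(a <- s) ('X - a%:P)].

(* p is a 1-based index, as in lambda_1 <= ... <= lambda_n. *)
Definition lambda (R : realType) (n : nat) (M : 'M[R]_n) (p : nat) : R :=
  (eigenvalues M)`_p.-1.

(* Euclidean norm: the norm `|v| of the library is the maximum norm. *)
Definition unit_sphere {R : realType} {n : nat} : set 'cV[R]_n :=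
  [set v | Num.sqrt (\sum_i v i 0 ^+ 2) = 1].

Definition linear_span (R : realType) (n : nat) (S : set 'cV[R]_n) :
    set 'cV[R]_n :=
  [set v | exists2 s : seq 'cV[R]_n,
             (forall w, w \in s -> S w) & v \in span s].

Definition unit_eigenvectors (R : realType) (n : nat) (M : 'M[R]_n) (p : nat) :
    set 'cV[R]_n :=
  [set v | unit_sphere v /\ M *m v = lambda M p *: v].

Definition unit_eigenspan (R : realType) (n : nat) (M : 'M[R]_n) (I : set nat) :
    set 'cV[R]_n :=
  linear_span (\bigcup_(p in I) unit_eigenvectors M p) `&` unit_sphere.

(* 0 is a junk value, used only when S has no least element. *)
Definition min_of (R : realType) (S : set R) : R :=
  xget 0 [set m | S m /\ lbound S m].

Definition state_derivative (R : realType) (N n : nat)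
    (L : 'cV[R]_N -> 'M[R]_n) (x u : 'cV[R]_N) : 'M[R]_n :=
  \sum_(i < N) u i 0 *: 'D_(delta_mx i 0) L x.

Definition mu (R : realType) (N n : nat) (L : 'cV[R]_N -> 'M[R]_n)
    (I : set nat) (x u : 'cV[R]_N) : R :=
  min_of [set (v^T *m state_derivative L x u *m v) 0 0
         | v in unit_eigenspan (L x) I].

Definition nat_range (a b : nat) : set nat := [set p | (a <= p <= b)%N].

Definition U_range (R : realType) (N n : nat) (L : 'cV[R]_N -> 'M[R]_n)
    (alpha : R -> R) (eps : R) (m : nat) (x : 'cV[R]_N) : set 'cV[R]_N :=
  [set u | - alpha (lambda (L x) m - eps) <= mu L (nat_range 2 m) x u].

Definition U_agg (R : realType) (N n : nat) (L : 'cV[R]_N -> 'M[R]_n)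
    (alpha : R -> R) (eps : R) (x : 'cV[R]_N) : set 'cV[R]_N :=
  \bigcap_(m in nat_range 2 n) U_range L alpha eps m x.

Definition U_nom (R : realType) (N dnom : nat)
    (g : 'cV[R]_N -> 'cV[R]_N -> 'cV[R]_dnom) (x : 'cV[R]_N) : set 'cV[R]_N :=
  [set u | forall i, g x u i 0 <= 0].

Definition argmin (R : realType) (N : nat) (f : 'cV[R]_N -> R)
    (U : set 'cV[R]_N) : set 'cV[R]_N :=
  [set u | U u /\ forall v, U v -> f u <= f v].

Definition C_set (R : realType) (N n : nat) (L : 'cV[R]_N -> 'M[R]_n) (eps : R) :
    set 'cV[R]_N :=
  [set x | eps <= lambda (L x) 2].

Definition extended_class_K (R : realType) (alpha : R -> R) : Prop :=
  [/\ continuous alpha, {homo alpha : s t / s < t} & alpha 0 = 0].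

Definition locally_lipschitz (R : realType) (f : R -> R) : Prop :=
  forall s : R, exists2 V : set R, nbhs s V & [lipschitz f t | t in V].

(* In finite dimension, continuity of x |-> 'd A x in operator norm is
   continuity of x |-> 'd A x v for every v. *)
Definition continuously_differentiable (R : realType) (N n : nat)
    (A : 'cV[R]_N -> 'M[R]_n) : Prop :=
  (forall x, differentiable A x) /\
  (forall v, continuous (fun x => 'd A x v)).

Definition strictly_convex (R : realType) (N : nat) (f : 'cV[R]_N -> R) : Prop :=
  forall (u v : 'cV[R]_N) (t : R), u != v -> 0 < t -> t < 1 ->
    f (t *: u + (1 - t) *: v) < t * f u + (1 - t) * f v.

(* A list of pairs (a_k, b_k) encodes a finite family of subintervals of
   [a, b] with pairwise disjoint interiors. *)
Definition absolutely_continuous (R : realType) (N : nat) (a b : R)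
    (f : R -> 'cV[R]_N) : Prop :=
  forall e : R, 0 < e -> exists2 d : R, 0 < d &
    forall s : seq (R * R),
      (forall J, J \in s -> [/\ a <= J.1, J.1 <= J.2 & J.2 <= b]) ->
      pairwise [rel J K | (J.2 <= K.1) || (K.2 <= J.1)] s ->
      \sum_(J <- s) (J.2 - J.1) < d ->
      \sum_(J <- s) `|f J.2 - f J.1| < e.

(* On a non-compact time interval T, absolute continuity is required on the
   compact subintervals. Only the values of x on T matter: the endpoints of T
   form a null set. *)
Definition caratheodory_solution (R : realType) (N : nat)
    (k : 'cV[R]_N -> 'cV[R]_N) (T : set R) (x : R -> 'cV[R]_N) : Prop :=
  (forall a b, T a -> T b -> absolutely_continuous a b x) /\
  {ae lebesgue_measure, forall t : R, T t -> is_derive t (1 : R) x (k (x t))}.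

(* Main.v *)
From HB Require Import structures.
From mathcomp Require Import perm zify ring lra.
Require Import Defs.
Import Order.TTheory GRing.Theory Num.Theory.
Local Open Scope classical_set_scope.
Local Open Scope ring_scope.
Set Implicit Arguments.
Unset Strict Implicit.
Unset Printing Implicit Defensive.

(** Continuity of the controller. The constraint of index m bounds the form
    v |-> v^T L'(x, u) v from below on the unit vectors of the sum of the
    eigenspaces of lambda_2, ..., lambda_m, and this sum is the kernel of
    (L - lambda_2) ... (L - lambda_m) ([unit_eigenspanP]). The ordered eigenvalues
    are Lipschitz functions of a symmetric matrix ([lambda_lipschitz]), so these
    products are continuous in the state, and a limit of kernel vectors is a
    kernel vector. Compactness of the sphere then shows that an input satisfying
    the constraint strictly at x satisfies it at all states near x
    ([strict_feasibility_persists]).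

    Conversely an input violating a constraint at x keeps violating one after
    small changes of both state and input ([infeasibility_persists]). The kernels
    may shrink when a multiple eigenvalue splits, but the constraints of all the
    indices of a cluster lambda_m = ... = lambda_M agree at x, and the one of the
    last index M is stable: as lambda_1 <= 0 < lambda_2 and
    lambda_M < lambda_(M+1), every vector v of its kernel is the image of some w
    under the product of the remaining factors L - lambda_1, L - lambda_(M+1),
    ..., L - lambda_n, and at a nearby state y the same product applied to w is
    close to v and, by Cayley-Hamilton, lies in the kernel at y. This
    is where lambda_2 > 0, and so the restriction to C_eps, enters.

    Feasible sets that are convex, have strictly feasible points and vary
    continuously in this sense have a continuous minimizer of a continuous
    strictly convex cost ([berge]).

    Invariance. Along a trajectory put h(t) = lambda_2(L(x(t))). It is a locally
    Lipschitz function of an absolutely continuous curve. While h > 0, h is the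
    minimum of the Rayleigh quotient over the vectors orthogonal to the constants,
    so comparing L(x(s)) and L(x(t)) on an eigenvector of one of them bounds the
    increments of h below, to first order, by mu_{2}(x, k(x)), hence by
    - alpha (h - eps) ([lambda2_lower_derivative]). This is nonnegative while
    h <= eps, and such a function is nondecreasing ([ac_nondecreasing]): it cannot
    leave eps downwards ([barrier_stays_above]). Finally lambda_2 > 0 forces the
    kernel of L to consist of the constant vectors, and it contains the indicator
    of a connected component, so the graph is connected ([laplacian_connected]). *)

(** * Matrix limits, quadratic forms and compactness *)

Definition sqnorm (R : realType) (n : nat) (v : 'cV[R]_n) : R :=
  \sum_i v i 0 ^+ 2.

Definition qform (R : realType) (n : nat) (M : 'M[R]_n) (v : 'cV[R]_n) : R :=
  (v^T *m M *m v) 0 0.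

Lemma coord_le_norm (R : realType) m n (A : 'M[R]_(m, n)) i j : `|A i j| <= `|A|.
Proof.
rewrite [leRHS]/Num.Def.normr /= mx_normrE.
exact: (le_bigmax _ (fun ij => `|A ij.1 ij.2|) (i, j)).
Qed.

Lemma mx_norm_le (R : realType) m n (A : 'M[R]_(m, n)) (c : R) :
  0 <= c -> (forall i j, `|A i j| <= c) -> `|A| <= c.
Proof.
move=> c0 h; rewrite [leLHS]/Num.Def.normr /= mx_normrE bigmax_le//= => ij _.
Qed.

Section MatrixConvergence.
Context {R : realType} {T : Type} {F : set_system T} {FF : Filter F}.

Lemma cvg_mxP m n (f : T -> 'M[R]_(m, n)) (l : 'M[R]_(m, n)) :
  (forall i j, f t i j @[t --> F] --> l i j) -> f t @[t --> F] --> l.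
Proof.
move=> fl; apply/cvgrPdist_le => e e0; near=> t.
apply: mx_norm_le => [|i j]; first exact: ltW.
rewrite !mxE/=; move: i j; near: t.
apply: filter_forall => i; apply: filter_forall => j.
exact: ((cvgrPdist_le _ _).1 (fl i j)).
Unshelve. all: by end_near. Qed.

Lemma cvg_coord m n (f : T -> 'M[R]_(m, n)) (l : 'M[R]_(m, n)) i j :
  f t @[t --> F] --> l -> f t i j @[t --> F] --> l i j.
Proof. by move=> fl; apply: cvg_comp fl (@coord_continuous _ _ _ i j l). Qed.

Lemma cvg_sumr (I : Type) (r : seq I) (P : pred I) (f : I -> T -> R) (a : I -> R) :
  (forall i, P i -> f i t @[t --> F] --> a i) ->
  \sum_(i <- r | P i) f i t @[t --> F] --> \sum_(i <- r | P i) a i.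
Proof. by move=> fa; apply: cvg_big => //; exact: add_continuous. Qed.

Lemma cvg_mulmx m n p (f : T -> 'M[R]_(m, n)) (g : T -> 'M[R]_(n, p))
    (lf : 'M[R]_(m, n)) (lg : 'M[R]_(n, p)) :
  f t @[t --> F] --> lf -> g t @[t --> F] --> lg ->
  f t *m g t @[t --> F] --> lf *m lg.
Proof.
move=> fl gl; apply: cvg_mxP => i j.
rewrite mxE; under eq_fun do rewrite mxE.
by apply: cvg_sumr => k _; apply: cvgM; apply: cvg_coord.
Qed.

Lemma cvg_trmx m n (f : T -> 'M[R]_(m, n)) (l : 'M[R]_(m, n)) :
  f t @[t --> F] --> l -> (f t)^T @[t --> F] --> l^T.
Proof.
move=> fl; apply: cvg_mxP => i j.
by rewrite mxE; under eq_fun do rewrite mxE; apply: cvg_coord.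
Qed.

Lemma cvg_qform n (B : T -> 'M[R]_n) (v : T -> 'cV[R]_n)
    (B0 : 'M[R]_n) (v0 : 'cV[R]_n) :
  B t @[t --> F] --> B0 -> v t @[t --> F] --> v0 ->
  qform (B t) (v t) @[t --> F] --> qform B0 v0.
Proof.
move=> hB hv; apply: cvg_coord; apply: cvg_mulmx => //.
by apply: cvg_mulmx => //; apply: cvg_trmx.
Qed.

Lemma cvg_sqnorm n (v : T -> 'cV[R]_n) (v0 : 'cV[R]_n) :
  v t @[t --> F] --> v0 -> sqnorm (v t) @[t --> F] --> sqnorm v0.
Proof.
move=> hv; apply: cvg_sumr => i _; under eq_fun do rewrite expr2.
by rewrite expr2; apply: cvgM; apply: cvg_coord.
Qed.

End MatrixConvergence.

Section EuclideanNorm.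
Context {R : realType}.

Lemma sqnormE n (v : 'cV[R]_n) : sqnorm v = (v^T *m v) 0 0.
Proof. by rewrite mxE; apply: eq_bigr => i _; rewrite mxE expr2. Qed.

Lemma sqnorm_ge0 n (v : 'cV[R]_n) : 0 <= sqnorm v.
Proof. by apply: sumr_ge0 => i _; rewrite sqr_ge0. Qed.

Lemma sqnorm_eq0 n (v : 'cV[R]_n) : sqnorm v = 0 -> v = 0.
Proof.
move=> /eqP; rewrite psumr_eq0 => [/allP h|i _]; last by rewrite sqr_ge0.
apply/colP => i; have := h i; rewrite mem_index_enum => /(_ isT) /=.
by rewrite sqrf_eq0 mxE => /eqP.
Qed.

Lemma sqnorm_gt0 n (v : 'cV[R]_n) : v != 0 -> 0 < sqnorm v.
Proof.
move=> v0; rewrite lt_neqAle sqnorm_ge0 andbT eq_sym.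
by apply: contra_neq v0; apply: sqnorm_eq0.
Qed.

Lemma sqnormZ n a (v : 'cV[R]_n) : sqnorm (a *: v) = a ^+ 2 * sqnorm v.
Proof. by rewrite /sqnorm mulr_sumr; apply: eq_bigr => i _; rewrite mxE exprMn. Qed.

Lemma qformZ n (M : 'M[R]_n) a v : qform M (a *: v) = a ^+ 2 * qform M v.
Proof.
by rewrite /qform [(a *: v)^T]linearZ /= -!scalemxAl -scalemxAr !mxE mulrA.
Qed.

Lemma unit_sphereP n (v : 'cV[R]_n) : unit_sphere v <-> sqnorm v = 1.
Proof.
rewrite /unit_sphere /= -/(sqnorm v); split=> [h|->]; last exact: sqrtr1.
by rewrite -(sqr_sqrtr (sqnorm_ge0 v)) h expr1n.
Qed.

Lemma sqnorm_delta n (i : 'I_n) : sqnorm (delta_mx i 0 : 'cV[R]_n) = 1.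
Proof.
rewrite /sqnorm (bigD1 i)//= mxE !eqxx expr1n big1 ?addr0// => j ji.
by rewrite mxE (negbTE ji) expr0n.
Qed.

Lemma unit_normalize n (v : 'cV[R]_n) :
  v != 0 -> sqnorm ((Num.sqrt (sqnorm v))^-1 *: v) = 1.
Proof.
move=> v0; rewrite sqnormZ exprVn sqr_sqrtr ?sqnorm_ge0// mulVf//.
by rewrite gt_eqF// sqnorm_gt0.
Qed.

(** Transposition is a homeomorphism onto row vectors, where Heine-Borel applies. *)
Lemma compact_cV n (A : set 'cV[R]_n) : bounded_set A -> closed A -> compact A.
Proof.
move=> bA cA; pose f (v : 'rV[R]_n) : 'cV[R]_n := v^T.
have cf : continuous f by move=> v; apply: (@cvg_trmx _ _ (nbhs v)); exact: cvg_id.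
have -> : A = f @` (f @^-1` A).
  apply/seteqP; split=> [v Av|v [w Aw <-]//].
  by exists (v^T); rewrite /f /= trmxK.
apply: continuous_compact; first by apply: continuous_subspaceT.
apply: bounded_closed_compact; last first.
  by move: cA; rewrite /f; apply: (@preimage_closed _ _ f).
have [M [Mr hM]] := bA; exists M; split=> // x Mx v /= /(hM x Mx) h.
apply: mx_norm_le => [|i j]; first exact: le_trans h.
apply: le_trans h; rewrite (_ : v i j = v^T j i); last by rewrite mxE.
exact: coord_le_norm.
Qed.

End EuclideanNorm.

Section Sphere.
Context {R : realType}.

Lemma qformD n (A B : 'M[R]_n) (v : 'cV[R]_n) : qform (A + B) v = qform A v + qform B v.
Proof. by rewrite /qform mulmxDr mulmxDl mxE. Qed.

Lemma qformB n (A B : 'M[R]_n) (v : 'cV[R]_n) : qform (A - B) v = qform A v - qform B v.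
Proof. by rewrite /qform mulmxBr mulmxBl !mxE. Qed.

Lemma qformZl n a (A : 'M[R]_n) (v : 'cV[R]_n) : qform (a *: A) v = a * qform A v.
Proof. by rewrite /qform -scalemxAr -scalemxAl mxE. Qed.

Lemma qform_scalar n a (v : 'cV[R]_n) : qform a%:M v = a * sqnorm v.
Proof. by rewrite /qform mul_mx_scalar -scalemxAl mxE sqnormE. Qed.

Lemma sqr_coord_le_sqnorm n (v : 'cV[R]_n) i : v i 0 ^+ 2 <= sqnorm v.
Proof.
rewrite /sqnorm (bigD1 i) //= lerDl; apply: sumr_ge0 => j _; exact: sqr_ge0.
Qed.

(** The factor n is the price of the maximum norm: it comes from bounding
    |v_i v_j| by the mean of the two squares and summing over all pairs. *)
Lemma qform_le_norm n (B : 'M[R]_n) (v : 'cV[R]_n) :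
  `|qform B v| <= n%:R * `|B| * sqnorm v.
Proof.
have -> : qform B v = \sum_i \sum_j v i 0 * B i j * v j 0.
  rewrite /qform mxE exchange_big /=; apply: eq_bigr => j _.
  by rewrite mxE mulr_suml; apply: eq_bigr => i _; rewrite mxE.
apply: (@le_trans _ _ (\sum_(i < n) \sum_(j < n)
    (`|B| * ((v i 0 ^+ 2 + v j 0 ^+ 2) / 2)))).
  apply: le_trans (ler_norm_sum _ _ _) _; apply: ler_sum => i _.
  apply: le_trans (ler_norm_sum _ _ _) _; apply: ler_sum => j _.
  rewrite !normrM mulrAC mulrC; apply: ler_pM => //.
  - exact: coord_le_norm.
  - rewrite -(real_normK (num_real (v i 0))) -(real_normK (num_real (v j 0))).
    have := sqr_ge0 (`|v i 0| - `|v j 0|); rewrite sqrrB.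
    rewrite ler_pdivlMr//; lra.
under eq_bigr do rewrite -mulr_sumr; rewrite -mulr_sumr.
rewrite -mulrA mulrCA ler_wpM2l//.
under eq_bigr do rewrite -mulr_suml big_split/= sumr_const card_ord.
rewrite -mulr_suml big_split /= sumrMnl sumr_const card_ord -/(sqnorm v).
by rewrite -mulrnDl -mulr2n mulr_natl -mulrnA mulnC mulrnA -[_ *+ 2]mulr_natr mulfK.
Qed.

Lemma compact_sphere n : compact [set v : 'cV[R]_n | sqnorm v = 1].
Proof.
apply: compact_cV.
  exists 1; split=> // x x1 v /= v1; apply/ltW.
  rewrite [ltLHS]/Num.Def.normr /= mx_normrE bigmax_lt ?(lt_trans _ x1)//.
  move=> [i j] _ /=; rewrite (ord1 j).
  apply: le_lt_trans x1; rewrite -(@ler_pXn2r _ 2) ?nnegrE// expr1n.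
  by rewrite real_normK ?num_real// -v1 sqr_coord_le_sqnorm.
have -> : [set v : 'cV[R]_n | sqnorm v = 1] = @sqnorm R n @^-1` [set 1].
  by apply/seteqP; split.
apply: preimage_closed; last exact: closed_eq.
by move=> v *; exact: (@cvg_sqnorm R _ (nbhs v) _ n id v cvg_id).
Qed.

(** * The spectral theorem for real symmetric matrices *)

Lemma qform_cross n (B : 'M[R]_n) (v w : 'cV[R]_n) t : B^T = B ->
  qform B (v + t *: w) =
  qform B v + 2 * t * (w^T *m (B *m v)) 0 0 + t ^+ 2 * qform B w.
Proof.
move=> Bs; have e : (v^T *m (B *m w)) 0 0 = (w^T *m (B *m v)) 0 0.
  transitivity ((v^T *m (B *m w))^T 0 0); first by rewrite [RHS]mxE.
  by rewrite !trmx_mul trmxK Bs mulmxA.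
rewrite /qform [(v + _)^T]linearD /= mulmxDl mulmxDl !mulmxDr [(t *: w)^T]linearZ /=.
rewrite -!scalemxAr -!scalemxAl -!mulmxA.
have ad (X Y : 'M[R]_(1, 1)) : (X + Y) 0 0 = X 0 0 + Y 0 0 by rewrite mxE.
have sc (c : R) (X : 'M[R]_(1, 1)) : (c *: X) 0 0 = c * X 0 0 by rewrite mxE.
by rewrite !(ad, sc) e -addrA; ring.
Qed.

Lemma sqnorm_cross n (v w : 'cV[R]_n) t :
  sqnorm (v + t *: w) =
  sqnorm v + 2 * t * (w^T *m v) 0 0 + t ^+ 2 * sqnorm w.
Proof.
have h (u : 'cV[R]_n) : sqnorm u = qform 1%:M u by rewrite qform_scalar mul1r.
by rewrite !h qform_cross ?trmx1// mul1mx.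
Qed.

(** Moving from v in the direction - B v decreases the form to first order at
    the rate 2 |B v|^2, which a nonnegative form vanishing at v does not allow. *)
Lemma psd_qform_eq0 n (B : 'M[R]_n) (v : 'cV[R]_n) : B^T = B ->
  (forall w, 0 <= qform B w) -> qform B v = 0 -> B *m v = 0.
Proof.
move=> Bs Bge0 Bv; apply: sqnorm_eq0; apply: le_anti; rewrite sqnorm_ge0 andbT.
set w := B *m v; have h t : 0 <= 2 * t * sqnorm w + t ^+ 2 * qform B w.
  by have := Bge0 (v + t *: w); rewrite qform_cross// Bv add0r -sqnormE.
rewrite leNgt; apply/negP => w0.
have q0 := Bge0 w.
have k0 : 0 < qform B w + 1 by rewrite ltr_wpDl.
(* a step short enough for the first-order term to win; the + 1 keeps the
   denominator positive *)
have := h (- (sqnorm w / (qform B w + 1))).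
have : sqnorm w / (qform B w + 1) > 0 by rewrite divr_gt0.
have : (sqnorm w / (qform B w + 1)) * (qform B w + 1) = sqnorm w.
  by rewrite divfK// gt_eqF.
set s := sqnorm w in w0 *; set q := qform B w in q0 k0 *; set a := s / _.
nra.
Qed.

(** A minimizer v of the form on the sphere, with minimum a, makes M - a positive
    semidefinite with a null vector v, so (M - a) v = 0. *)
Lemma symmetric_eigenvector n (M : 'M[R]_n.+1) : M^T = M ->
  exists (v : 'cV[R]_n.+1) (a : R), sqnorm v = 1 /\ M *m v = a *: v.
Proof.
move=> Ms; have [||v v1 vmin] :=
  @compact_EVT_min _ R (qform M) _ _ (@compact_sphere n.+1).
- by exists (delta_mx 0 0); exact: sqnorm_delta.
- apply: continuous_subspaceT => v.
  exact: (@cvg_qform R _ (nbhs v) _ n.+1 (cst M) id M v (cvg_cst _) cvg_id).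
have h (w : 'cV[R]_n.+1) : qform M v * sqnorm w <= qform M w.
  have [->|w0] := eqVneq w 0.
    rewrite -(scale0r (0 : 'cV[R]_n.+1)) sqnormZ qformZ expr0n /=.
    by rewrite !mul0r mulr0.
  have := vmin _ (mem_set (unit_normalize w0)); rewrite qformZ exprVn.
  by rewrite sqr_sqrtr ?sqnorm_ge0// mulrC ler_pdivlMr ?sqnorm_gt0.
have v1' : sqnorm v = 1 by apply: set_mem v1.
exists v, (qform M v); split=> //.
apply/eqP; rewrite -subr_eq0 -mul_scalar_mx -mulmxBl; apply/eqP.
apply: psd_qform_eq0.
- by rewrite linearB /= Ms tr_scalar_mx.
- by move=> w; rewrite qformB qform_scalar subr_ge0.
- by rewrite qformB qform_scalar v1' mulr1 subrr.
Qed.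

(** The reflection exchanging e_0 and v, along w = v - e_0. *)
Lemma householder n (v : 'cV[R]_n.+1) : sqnorm v = 1 ->
  exists2 H : 'M[R]_n.+1, H^T *m H = 1%:M & col 0 H = v.
Proof.
move=> v1; have [->|ve] := eqVneq v (delta_mx 0 0).
  exists 1%:M; first by rewrite trmx1 mul1mx.
  by apply/colP => i; rewrite !mxE eqxx andbT.
pose e : 'cV[R]_n.+1 := delta_mx 0 0; pose w := v - e.
have e1 : sqnorm e = 1 by exact: sqnorm_delta.
have w0 : sqnorm w != 0.
  by apply: contra_neq ve => /sqnorm_eq0 /eqP; rewrite subr_eq0 => /eqP.
pose H := 1%:M - (2 / sqnorm w) *: (w *m w^T).
have Hs : H^T = H by rewrite /H linearB linearZ /= trmx_mul trmxK trmx1.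
have ww : w *m w^T *m (w *m w^T) = sqnorm w *: (w *m w^T).
  rewrite mulmxA -(mulmxA w) (mx11_scalar (w^T *m w)) -sqnormE.
  by rewrite mul_mx_scalar -scalemxAl.
exists H.
  rewrite Hs mulmxBl !mulmxBr !mul1mx mulmx1 -scalemxAl -scalemxAr ww.
  move: (w *m w^T) => P; rewrite !scalerA.
  have -> : 2 / sqnorm w * (2 / sqnorm w) * sqnorm w =
            2 / sqnorm w + 2 / sqnorm w by field.
  by rewrite scalerDl; apply/matrixP => i j; rewrite !mxE; ring.
have -> : col 0 H = H *m e by rewrite -colE.
have we : (w^T *m e) 0 0 = - (sqnorm w / 2).
  have := sqnorm_cross e w 1; rewrite scale1r expr1n mul1r addrC subrK v1 e1.
  by move=> h; lra.
rewrite mulmxBl mul1mx -scalemxAl -mulmxA (mx11_scalar (w^T *m e)) we.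
rewrite mul_mx_scalar scalerA mulrN mulrA divfK// divff ?pnatr_eq0//.
by rewrite scaleN1r opprK addrC subrK.
Qed.

(** In an orthonormal basis starting with an eigenvector, a symmetric matrix is
    block diagonal; the induction diagonalizes the remaining block. *)
Lemma orthogonal_diagonalization n (M : 'M[R]_n) : M^T = M ->
  exists (Q : 'M[R]_n) (d : 'rV[R]_n), Q^T *m Q = 1%:M /\ M = Q *m diag_mx d *m Q^T.
Proof.
elim: n M => [|n IH] M Ms.
  by exists 1%:M, 0; split; apply/matrixP => -[].
have [v [a [v1 Mv]]] := symmetric_eigenvector Ms.
have [H HH Hv] := householder v1.
have HH' : H *m H^T = 1%:M by apply: mulmx1C.
pose B : 'M[R]_(1 + n) := H^T *m M *m H.
have Bs : B^T = B by rewrite /B !trmx_mul trmxK Ms mulmxA.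
have B0 : col 0 B = a *: delta_mx 0 0.
  have Hv' : H *m delta_mx 0 0 = v by rewrite -colE.
  by rewrite colE /B -!mulmxA Hv' Mv -scalemxAr -Hv' mulmxA HH mul1mx.
have MB : M = H *m B *m H^T.
  by rewrite /B !mulmxA HH' mul1mx -mulmxA HH' mulmx1.
move: B Bs B0 MB => B Bs B0 MB.
have Bd : B = block_mx a%:M 0 0 (drsubmx B).
  rewrite -[LHS](submxK B).
  have b1 : ulsubmx B = a%:M.
    apply/matrixP => i j; rewrite !ord1 mxE.
    have := congr1 (fun C : 'cV[R]_(1 + n) => C 0 0) B0.
    by rewrite !mxE !eqxx mulr1 => <-; congr (B _ _); apply: val_inj.
  have b2 : dlsubmx B = 0.
    apply/matrixP => i j; rewrite !ord1 mxE.
    have := congr1 (fun C : 'cV[R]_(1 + n) => C (rshift 1 i) 0) B0.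
    rewrite !mxE /= mulr0 => <-; congr (B _ _); exact: val_inj.
  have b3 : ursubmx B = 0 by rewrite -[B]Bs -trmx_dlsub b2 trmx0.
  by rewrite b1 b2 b3.
have [|Q [d [QQ Bd']]] := IH (drsubmx B).
  by rewrite trmx_drsub Bs.
pose P : 'M[R]_(1 + n) := block_mx 1%:M 0 0 Q.
have PP : P^T *m P = 1%:M.
  rewrite /P tr_block_mx mulmx_block !trmx0 !trmx1 QQ !mulmx0 !mul0mx.
  by rewrite !addr0 add0r mulmx1 -scalar_mx_block.
have PD : P *m diag_mx (row_mx a%:M d) *m P^T = B.
  rewrite Bd Bd' /P tr_block_mx diag_mx_row !mulmx_block.
  rewrite !trmx0 !trmx1 !mulmx0 !mul0mx !mul1mx !mulmx1 !addr0 !add0r.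
  suff -> : diag_mx a%:M = a%:M :> 'M[R]_1 by rewrite mul0mx.
  by apply/matrixP => i j; rewrite !ord1 !mxE !mulr1n.
exists (H *m P), (row_mx a%:M d); split.
  by rewrite trmx_mul mulmxA -(mulmxA _ H^T) HH mulmx1 PP.
by rewrite MB -PD trmx_mul !mulmxA.
Qed.

End Sphere.

(** * Ordered eigenvalues and eigenbases *)

Section Eigenbasis.
Context {R : realType}.

Lemma scale_mxE m n (a : R) (A : 'M[R]_(m, n)) i j : (a *: A) i j = a * A i j.
Proof. by rewrite mxE. Qed.

Lemma sub_mxE m n (A B : 'M[R]_(m, n)) i j : (A - B) i j = A i j - B i j.
Proof. by rewrite !mxE. Qed.

Lemma prod_XsubC_sorted_inj (s t : seq R) : sorted <=%R s -> sorted <=%R t ->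
  \prod_(a <- s) ('X - a%:P) = \prod_(a <- t) ('X - a%:P) -> s = t.
Proof.
by move=> ss st e; apply: le_sorted_eq ss st _; apply/prod_XsubC_eq.
Qed.

Lemma char_poly_conj n (Q D : 'M[R]_n) : Q^T *m Q = 1%:M ->
  char_poly (Q *m D *m Q^T) = char_poly D.
Proof.
move=> QQ; have QQ' : Q *m Q^T = 1%:M by apply: mulmx1C.
rewrite /char_poly /char_poly_mx !map_mxM.
set q := map_mx polyC Q; set p := map_mx polyC Q^T.
have qp : q *m p = 1%:M by rewrite -map_mxM QQ' map_mx1.
have -> : 'X%:M - q *m map_mx polyC D *m p = q *m ('X%:M - map_mx polyC D) *m p.
  by rewrite mulmxBr mulmxBl mul_mx_scalar -scalemxAl qp scalemx1.
by rewrite !det_mulmx mulrAC -det_mulmx qp det1 mul1r.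
Qed.

Lemma eigenvalues_eq n (M : 'M[R]_n) s :
  sorted <=%R s -> char_poly M = \prod_(a <- s) ('X - a%:P) ->
  eigenvalues M = s.
Proof.
move=> ss e; rewrite /eigenvalues; case: xgetP => [t _ [st et]|/(_ s)[]//].
by apply: prod_XsubC_sorted_inj => //; rewrite -et.
Qed.

Lemma eigenvalues_diagonalized n (M Q : 'M[R]_n) (d : 'rV[R]_n) :
  Q^T *m Q = 1%:M -> M = Q *m diag_mx d *m Q^T ->
  eigenvalues M = sort <=%R [seq d 0 i | i <- enum 'I_n].
Proof.
move=> QQ Md; apply: eigenvalues_eq; first exact: sort_le_sorted.
rewrite Md char_poly_conj// char_poly_trig ?diag_mx_is_trig//.
set s := map _ _; rewrite (perm_big s) /=; last by rewrite perm_sort.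
by rewrite big_map big_enum /=; apply: eq_bigr => i _; rewrite mxE eqxx.
Qed.

(** The columns of Q are orthonormal eigenvectors listed in the order of the
    eigenvalues; Q^T v is then the vector of the coordinates of v. *)
Definition eigenbasis n (M Q : 'M[R]_n) : Prop :=
  Q^T *m Q = 1%:M /\ M = Q *m diag_mx (\row_(i < n) lambda M i.+1) *m Q^T.

Lemma eigenbasis_exists n (M : 'M[R]_n) : M^T = M -> exists Q, eigenbasis M Q.
Proof.
move=> Ms; have [P [d [PP Md]]] := orthogonal_diagonalization Ms.
pose s := [seq d 0 i | i <- enum 'I_n].
have szs : size s == n by rewrite size_map size_enum_ord.
have szt : size (sort <=%R s) == n by rewrite size_sort.
have ev : eigenvalues M = sort <=%R s by exact: eigenvalues_diagonalized Md.
have /tuple_permP[p pE] : perm_eq (Tuple szt) (Tuple szs) by rewrite perm_sort.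
have dE (i : 'I_n) : lambda M i.+1 = d 0 (p i).
  have := congr1 (fun t => nth 0 t i) pE; rewrite /lambda ev /= => ->.
  rewrite (nth_map i) ?size_enum_ord// nth_ord_enum (tnth_nth 0) /=.
  by rewrite (nth_map i) ?size_enum_ord// nth_ord_enum.
exists (col_perm p P); split.
  rewrite col_permE trmx_mul mulmxA -[X in X *m _ = _]mulmxA PP mulmx1.
  by rewrite tr_perm_mx invgK -perm_mxM mulgV perm_mx1.
rewrite {1}Md; apply/matrixP => i j; rewrite !mul_mx_diag !mxE.
rewrite (reindex_inj (@perm_inj _ p)) /=.
by apply: eq_bigr => k _; rewrite !mxE dE.
Qed.

Lemma eigenvaluesP n (M : 'M[R]_n) : M^T = M ->
  size (eigenvalues M) = n /\ sorted <=%R (eigenvalues M).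
Proof.
move=> Ms; have [P [d [PP Md]]] := orthogonal_diagonalization Ms.
rewrite (eigenvalues_diagonalized PP Md) size_sort size_map size_enum_ord.
by rewrite sort_le_sorted.
Qed.

Lemma lambda_mono n (M : 'M[R]_n) p q : M^T = M ->
  (0 < p)%N -> (p <= q <= n)%N -> lambda M p <= lambda M q.
Proof.
move=> /eigenvaluesP[sz st]; case: p => // p _; case: q => // q /andP[pq qn].
by apply: (sorted_leq_nth le_trans le_refl _ st); rewrite ?inE ?sz //= (leq_trans pq).
Qed.

Lemma eigenbasisK n (M Q : 'M[R]_n) : eigenbasis M Q -> Q *m Q^T = 1%:M.
Proof. by case=> QQ _; apply: mulmx1C. Qed.

Lemma eigenbasis_sqnorm n (M Q : 'M[R]_n) (v : 'cV[R]_n) : eigenbasis M Q ->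
  sqnorm v = sqnorm (Q^T *m v).
Proof.
move=> /eigenbasisK QQ.
by rewrite !sqnormE trmx_mul trmxK mulmxA -(mulmxA v^T) QQ mulmx1.
Qed.

Lemma eigenbasis_coord_mul n (M Q : 'M[R]_n) (v : 'cV[R]_n) i : eigenbasis M Q ->
  (Q^T *m (M *m v)) i 0 = lambda M i.+1 * (Q^T *m v) i 0.
Proof.
case=> QQ MQ; rewrite {1}MQ -!mulmxA mulmxA QQ mul1mx mul_diag_mx !mxE //.
Qed.

Lemma eigenbasis_qform n (M Q : 'M[R]_n) (v : 'cV[R]_n) : eigenbasis M Q ->
  qform M v = \sum_(i < n) lambda M i.+1 * (Q^T *m v) i 0 ^+ 2.
Proof.
move=> eb; rewrite /qform -mulmxA -[M *m v]mul1mx -(eigenbasisK eb).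
rewrite -mulmxA mulmxA mxE; apply: eq_bigr => i _.
rewrite eigenbasis_coord_mul// mulrCA; congr (_ * _).
by rewrite expr2; congr (_ * _); rewrite -[v^T *m Q]trmxK trmx_mul trmxK mxE.
Qed.

Lemma eigenbasis_coord_inj n (M Q : 'M[R]_n) (v w : 'cV[R]_n) : eigenbasis M Q ->
  (forall i, (Q^T *m v) i 0 = (Q^T *m w) i 0) -> v = w.
Proof.
move=> /eigenbasisK QQ h; rewrite -[v]mul1mx -[w]mul1mx -QQ -!mulmxA.
by congr (_ *m _); apply/colP.
Qed.

Lemma eigenbasis_coord_col n (M Q : 'M[R]_n) i j : eigenbasis M Q ->
  (Q^T *m col j Q) i 0 = (i == j)%:R.
Proof. by move=> [QQ _]; rewrite colE mulmxA QQ mul1mx mxE andbT. Qed.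

Lemma eigenbasis_expand n (M Q : 'M[R]_n) (v : 'cV[R]_n) : eigenbasis M Q ->
  v = \sum_i (Q^T *m v) i 0 *: col i Q.
Proof.
move=> eb; apply: (eigenbasis_coord_inj eb) => i.
rewrite mulmx_sumr summxE (bigD1 i)//= big1 ?addr0 => [|j ji].
  by rewrite -scalemxAr scale_mxE (eigenbasis_coord_col _ _ eb) eqxx mulr1.
by rewrite -scalemxAr scale_mxE (eigenbasis_coord_col _ _ eb) eq_sym (negbTE ji) mulr0.
Qed.

Lemma eigenbasis_unit_eigenvector n (M Q : 'M[R]_n) (j : 'I_n) : eigenbasis M Q ->
  unit_eigenvectors M j.+1 (col j Q).
Proof.
move=> eb; split.
  apply/unit_sphereP; rewrite (eigenbasis_sqnorm _ eb) /sqnorm (bigD1 j)//=.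
  rewrite (eigenbasis_coord_col _ _ eb) eqxx expr1n big1 ?addr0// => i ij.
  by rewrite (eigenbasis_coord_col _ _ eb) (negbTE ij) expr0n.
apply: (eigenbasis_coord_inj eb) => i.
rewrite eigenbasis_coord_mul// -scalemxAr scale_mxE (eigenbasis_coord_col _ _ eb).
by case: eqP => [->|_]; rewrite ?mulr0.
Qed.

(** Courant-Fischer by dimension count: the span of the eigenvectors of A of index
    at least p and the span of those of B of index at most p have dimensions adding
    up to n + 1, so they share a vector v <> 0, for which
    lambda_p(A) |v|^2 <= v^T A v and v^T B v <= lambda_p(B) |v|^2. *)
Lemma lambda_le_perturb n (A B : 'M[R]_n) (p : 'I_n) : A^T = A -> B^T = B ->
  lambda A p.+1 <= lambda B p.+1 + n%:R * `|A - B|.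
Proof.
move=> As Bs; have [P eP] := eigenbasis_exists As.
have [Q eQ] := eigenbasis_exists Bs.
(* in the coordinates b of v in the basis Q, belonging to both spans is a square
   linear system whose row p is void *)
pose E : 'M[R]_n := \matrix_(i, j)
  if (i < p)%N then (P^T *m Q) i j else if (i == p) then 0 else (i == j)%:R.
have : \det E == 0.
  rewrite (expand_det_row _ p) big1// => j _.
  by rewrite mxE ltnn eqxx mul0r.
rewrite -det_tr => /det0P[u u0 uE].
pose b : 'cV[R]_n := u^T; pose v := Q *m b.
have Eb : E *m b = 0 by rewrite -[E]trmxK -trmx_mul uE trmx0.
have Qv : Q^T *m v = b by rewrite /v mulmxA eQ.1 mul1mx.
have v0 : 0 < sqnorm v.
  rewrite (eigenbasis_sqnorm _ eQ) Qv; apply: sqnorm_gt0.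
  by rewrite trmx_eq0.
have hP (i : 'I_n) : (i < p)%N -> (P^T *m v) i 0 = 0.
  move=> ip; have := congr1 (fun C : 'cV[R]_n => C i 0) Eb.
  by rewrite /v mulmxA !mxE => {2}<-; apply: eq_bigr => j _; rewrite !mxE ip.
have hQ (i : 'I_n) : (p < i)%N -> (Q^T *m v) i 0 = 0.
  move=> pi; have := congr1 (fun C : 'cV[R]_n => C i 0) Eb.
  rewrite Qv mxE (bigD1 i)//= !mxE ltnNge (ltnW pi) /= -val_eqE gtn_eqF// eqxx.
  rewrite mul1r big1 ?addr0// => j ji.
  by rewrite !mxE ltnNge (ltnW pi) /= -val_eqE gtn_eqF// eq_sym (negbTE ji) mul0r.
have h1 : lambda A p.+1 * sqnorm v <= qform A v.
  rewrite (eigenbasis_qform _ eP) (eigenbasis_sqnorm _ eP) mulr_sumr.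
  apply: ler_sum => i _; case: (ltnP i p) => [/hP->|pi].
    by rewrite expr0n !mulr0.
  by rewrite ler_wpM2r ?sqr_ge0// lambda_mono// !ltnS pi /=.
have h2 : qform B v <= lambda B p.+1 * sqnorm v.
  rewrite (eigenbasis_qform _ eQ) (eigenbasis_sqnorm _ eQ) mulr_sumr.
  apply: ler_sum => i _; case: (ltnP p i) => [/hQ->|ip].
    by rewrite expr0n !mulr0.
  by rewrite ler_wpM2r ?sqr_ge0// lambda_mono// !ltnS ip /=.
have := qform_le_norm (A - B) v; rewrite qformB => /(le_trans (ler_norm _)) h3.
rewrite -(ler_pM2r v0) mulrDl; lra.
Qed.

Lemma lambda_lipschitz n (A B : 'M[R]_n) (p : 'I_n) : A^T = A -> B^T = B ->
  `|lambda A p.+1 - lambda B p.+1| <= n%:R * `|A - B|.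
Proof.
move=> As Bs; have := lambda_le_perturb p As Bs.
have := lambda_le_perturb p Bs As; rewrite distrC => h1 h2.
by rewrite ler_norml; apply/andP; split; [rewrite distrC in h1 *|]; lra.
Qed.

(** * Kernels of products of factors M - lambda_p *)

(** The product over p in r of the factors M - lambda_p, applied to v. Acting on
    vectors avoids the ring of matrices, which needs a nonzero dimension. *)
Definition spec_prod n (M : 'M[R]_n) (r : seq nat) (v : 'cV[R]_n) : 'cV[R]_n :=
  foldr (fun p w => M *m w - lambda M p *: w) v r.

Lemma spec_prod_coord n (M Q : 'M[R]_n) r (v : 'cV[R]_n) i : eigenbasis M Q ->
  (Q^T *m spec_prod M r v) i 0 =
  (\prod_(p <- r) (lambda M i.+1 - lambda M p)) * (Q^T *m v) i 0.
Proof.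
move=> eb; elim: r => [|p r IH]; first by rewrite big_nil mul1r.
rewrite big_cons -mulrA -IH /= mulmxBr mulrBl.
by rewrite sub_mxE eigenbasis_coord_mul// -scalemxAr scale_mxE.
Qed.

Lemma spec_prodZ n (M : 'M[R]_n) r a (v : 'cV[R]_n) :
  spec_prod M r (a *: v) = a *: spec_prod M r v.
Proof.
elim: r => //= p r ->.
by rewrite -scalemxAr scalerBr !scalerA [lambda _ _ * _]mulrC.
Qed.

(** The Cayley-Hamilton theorem for two complementary groups of factors. *)
Lemma spec_prod_complement n (M : 'M[R]_n) r1 r2 (v : 'cV[R]_n) : M^T = M ->
  (forall i, (0 < i <= n)%N -> (i \in r1) || (i \in r2)) ->
  spec_prod M r1 (spec_prod M r2 v) = 0.
Proof.
move=> Ms cov; have [Q eb] := eigenbasis_exists Ms.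
apply: (eigenbasis_coord_inj eb) => i; rewrite mulmx0 [RHS]mxE.
rewrite !(spec_prod_coord _ _ _ eb) mulrA -big_cat /=.
rewrite (_ : \prod_(_ <- _) _ = 0) ?mul0r//.
apply/eqP; rewrite prodf_seq_eq0; apply/hasP; exists i.+1; last by rewrite /= subrr.
by rewrite mem_cat; apply: cov; rewrite /= ltn_ord.
Qed.

(** Trades the span of the eigenspaces for one equation that is continuous in M. *)
Lemma unit_eigenspanP n (M : 'M[R]_n) m (v : 'cV[R]_n) : M^T = M ->
  (2 <= m <= n)%N ->
  unit_eigenspan M (nat_range 2 m) v <->
  sqnorm v = 1 /\ spec_prod M (iota 2 m.-1) v = 0.
Proof.
move=> Ms /andP[m2 mn]; have [Q eb] := eigenbasis_exists Ms.
have mE p : (p \in iota 2 m.-1) = (2 <= p <= m)%N.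
  by rewrite mem_iota; congr (_ && _); case: m m2 {mn}.
split=> [[[s hs vs] /unit_sphereP v1]|[v1 qv]].
  split=> //; apply: (eigenbasis_coord_inj eb) => i; rewrite mulmx0 [RHS]mxE.
  rewrite (spec_prod_coord _ _ _ eb) (coord_span (X := in_tuple s) vs).
  rewrite mulmx_sumr summxE mulr_sumr big1// => j _.
  rewrite -scalemxAr scale_mxE mulrCA.
  have /hs[p pm [_ Mw]] : s`_j \in s by rewrite mem_nth.
  suff -> : \prod_(p0 <- iota 2 m.-1) (lambda M i.+1 - lambda M p0) *
     (Q^T *m s`_j) i 0 = 0 by rewrite mulr0.
  rewrite (big_rem p) ?mE//= -mulrA mulrCA; apply/eqP; rewrite mulf_eq0 orbC.
  rewrite mulrBl -(eigenbasis_coord_mul _ _ eb) Mw -scalemxAr scale_mxE.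
  by rewrite subrr eqxx.
split; last exact/unit_sphereP.
exists [seq col i Q | i <- enum 'I_n & (Q^T *m v) i 0 != 0].
  move=> w /mapP[i]; rewrite mem_filter => /andP[ci _] ->{w}.
  have := spec_prod_coord (iota 2 m.-1) v i eb.
  rewrite qv mulmx0 [LHS]mxE => /esym/eqP; rewrite mulf_eq0 (negbTE ci) orbF.
  rewrite prodf_seq_eq0 => /hasP[p]; rewrite mE => pm /= /eqP lE.
  exists p => //; have [h1 h2] := eigenbasis_unit_eigenvector i eb.
  by split=> //; rewrite h2; congr (_ *: _); apply/eqP; rewrite -subr_eq0 lE.
rewrite {1}(eigenbasis_expand v eb) big_mkcond /=; apply: memv_suml => i _.
have [->|ci] := eqVneq ((Q^T *m v) i 0) 0; first by rewrite scale0r mem0v.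
apply/memvZ/memv_span/map_f; by rewrite mem_filter ci mem_enum.
Qed.

End Eigenbasis.

(** * The Laplacian and connectivity *)

Section Laplacian.
Context {R : realType} {n : nat}.
Implicit Types (A : 'M[R]_n) (v : 'cV[R]_n).

Lemma laplacian_sym A : A^T = A -> (laplacian A)^T = laplacian A.
Proof. by move=> As; rewrite /laplacian linearB /= As tr_diag_mx. Qed.

Lemma laplacian_coord A v i :
  (laplacian A *m v) i 0 = \sum_j A i j * (v i 0 - v j 0).
Proof.
rewrite /laplacian mulmxBl sub_mxE mul_diag_mx !mxE mulr_suml -sumrB.
by apply: eq_bigr => j _; rewrite mulrBr.
Qed.

Lemma laplacian_const A a : laplacian A *m const_mx a = 0 :> 'cV_n.
Proof.
apply/colP => i; rewrite laplacian_coord [RHS]mxE big1// => j _.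
by rewrite !mxE subrr mulr0.
Qed.

Hypothesis hn : (2 <= n)%N.
Let i0 : 'I_n := Ordinal (ltnW hn).
Let i1 : 'I_n := Ordinal hn.

Lemma lambda1_laplacian_le0 A : A^T = A -> lambda (laplacian A) 1 <= 0.
Proof.
move=> As; have Ls := laplacian_sym As; have [Q eb] := eigenbasis_exists Ls.
have n1 : (0 : R) < sqnorm (const_mx 1 : 'cV[R]_n).
  apply: sqnorm_gt0; apply/eqP => /colP/(_ i0); rewrite !mxE => /eqP.
  by rewrite oner_eq0.
rewrite -(pmulr_lle0 _ n1).
have : qform (laplacian A) (const_mx 1) = 0.
  by rewrite /qform -mulmxA laplacian_const mulmx0 mxE.
rewrite (eigenbasis_qform _ eb) (eigenbasis_sqnorm _ eb) => <-.
rewrite mulr_sumr ler_sum// => i _; rewrite ler_wpM2r ?sqr_ge0//.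
by rewrite lambda_mono//=.
Qed.

(** When lambda_2 > 0 all coordinates but the first of a null vector vanish. *)
Lemma laplacian_coord0 A Q (w : 'cV[R]_n) : A^T = A ->
  0 < lambda (laplacian A) 2 -> eigenbasis (laplacian A) Q ->
  laplacian A *m w = 0 -> w = (Q^T *m w) i0 0 *: col i0 Q.
Proof.
move=> As l2 eb Lw; rewrite {1}(eigenbasis_expand w eb) (bigD1 i0)//=.
rewrite big1 ?addr0// => i ii0.
have := eigenbasis_coord_mul w i eb; rewrite Lw mulmx0 [LHS]mxE => /esym/eqP.
rewrite mulf_eq0 gt_eqF/= => [/eqP->|]; first by rewrite scale0r.
apply: lt_le_trans l2 _; apply: lambda_mono => //; first exact: laplacian_sym.
by rewrite ltn_ord andbT ltnS lt0n; apply: contra_neq ii0 => /= ii0; apply: val_inj.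
Qed.

(** Orthogonality to the constants is thus the vanishing of the first
    coordinate. *)
Lemma laplacian_const_col0 A Q : A^T = A ->
  0 < lambda (laplacian A) 2 -> eigenbasis (laplacian A) Q ->
  exists2 a : R, a != 0 & col i0 Q = a *: const_mx 1.
Proof.
move=> As l2 eb; have := laplacian_coord0 As l2 eb (laplacian_const A 1).
set c := (Q^T *m _) i0 0; move=> e; have c0 : c != 0.
  apply/eqP => c0; move: e; rewrite c0 scale0r => /colP/(_ i0).
  by rewrite !mxE => /eqP; rewrite oner_eq0.
by exists c^-1; rewrite ?invr_eq0// e scalerA mulVf// scale1r.
Qed.

Lemma laplacian_kernel A (w : 'cV[R]_n) : A^T = A ->
  0 < lambda (laplacian A) 2 -> laplacian A *m w = 0 ->
  exists a : R, w = a *: const_mx 1.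
Proof.
move=> As l2 Lw; have [Q eb] := eigenbasis_exists (laplacian_sym As).
have [a _ aE] := laplacian_const_col0 As l2 eb.
by rewrite (laplacian_coord0 As l2 eb Lw) aE scalerA; eexists.
Qed.

Lemma laplacian_rayleigh A v : A^T = A ->
  0 < lambda (laplacian A) 2 -> (const_mx 1 : 'cV_n)^T *m v = 0 ->
  lambda (laplacian A) 2 * sqnorm v <= qform (laplacian A) v.
Proof.
move=> As l2 v1; have Ls := laplacian_sym As.
have [Q eb] := eigenbasis_exists Ls.
have [a a0 aE] := laplacian_const_col0 As l2 eb.
rewrite (eigenbasis_qform _ eb) (eigenbasis_sqnorm _ eb) mulr_sumr.
apply: ler_sum => i _; have [->|ii0] := eqVneq i i0.
  have -> : (Q^T *m v) i0 0 = ((col i0 Q)^T *m v) 0 0.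
    by rewrite !mxE; apply: eq_bigr => j _; rewrite !mxE.
  by rewrite aE linearZ /= -scalemxAl v1 scaler0 mxE expr0n !mulr0.
rewrite ler_wpM2r ?sqr_ge0//; apply: lambda_mono => //.
by rewrite ltn_ord andbT ltnS lt0n; apply: contra_neq ii0 => /= ii0; apply: val_inj.
Qed.

Lemma laplacian_fiedler A : A^T = A -> 0 < lambda (laplacian A) 2 ->
  exists v, [/\ sqnorm v = 1, laplacian A *m v = lambda (laplacian A) 2 *: v &
    (const_mx 1 : 'cV_n)^T *m v = 0].
Proof.
move=> As l2; have Ls := laplacian_sym As.
have [Q eb] := eigenbasis_exists Ls.
have [/unit_sphereP u Lu] := eigenbasis_unit_eigenvector i1 eb.
exists (col i1 Q); split=> //.
have : (const_mx 1 : 'cV_n)^T *m (laplacian A *m col i1 Q) = 0.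
  by rewrite mulmxA -[X in _^T *m X]Ls -trmx_mul laplacian_const trmx0 mul0mx.
rewrite Lu -scalemxAr => /eqP; rewrite scaler_eq0 gt_eqF//= => /eqP //.
Qed.

(** The indicator of the vertices reachable from i is a null vector, hence
    constant; its value at i is 1. *)
Lemma laplacian_connected A : A^T = A -> (forall i j, 0 <= A i j) ->
  0 < lambda (laplacian A) 2 -> graph_connected A.
Proof.
move=> As A0 l2 i j; set e := [rel _ _ | _].
pose w : 'cV[R]_n := \col_l (connect e i l)%:R.
have Aji k l : A k l = A l k by rewrite -{1}As mxE.
have [|a wE] := laplacian_kernel (w := w) As l2.
  apply/colP => k; rewrite laplacian_coord [RHS]mxE big1// => l _.
  have [kl|] := boolP (e k l); last first.
    rewrite /= -leNgt => Akl; have -> : A k l = 0.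
      by apply: le_anti; rewrite Akl A0.
    by rewrite mul0r.
  have lk : e l k by rewrite /= Aji.
  have -> : w k 0 = w l 0; last by rewrite subrr mulr0.
  rewrite !mxE; congr (_%:R); congr nat_of_bool; apply/idP/idP => h.
    exact: connect_trans h (connect1 kl).
  exact: connect_trans h (connect1 lk).
have := congr1 (fun C : 'cV[R]_n => C i 0) wE.
have := congr1 (fun C : 'cV[R]_n => C j 0) wE.
rewrite !mxE connect0 mulr1 => <- /eqP.
by case: (connect e i j) => //; rewrite oner_eq0.
Qed.

End Laplacian.

(** * Continuity of the spectral data and the minimum mu *)

Section SpectralContinuity.
Context {R : realType} {T : Type} {F : set_system T} {FF : Filter F} {n : nat}.

Lemma cvg_lambda (M : T -> 'M[R]_n) (M0 : 'M[R]_n) p :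
  (forall t, (M t)^T = M t) -> M0^T = M0 -> (0 < p <= n)%N ->
  M t @[t --> F] --> M0 -> lambda (M t) p @[t --> F] --> lambda M0 p.
Proof.
move=> Ms M0s; case: p => // p /= pn MM0.
apply/cvgrPdist_lt => e e0.
have d0 : 0 < e / n.+1%:R by rewrite divr_gt0.
near=> t.
apply: le_lt_trans (lambda_lipschitz (Ordinal pn) M0s (Ms t)) _.
have h : `|M0 - M t| < e / n.+1%:R.
  by near: t; exact: ((cvgrPdist_lt _ _).1 MM0).
apply: le_lt_trans (_ : n.+1%:R * `|M0 - M t| < e).
  by rewrite ler_wpM2r// ler_nat.
by rewrite mulrC -ltr_pdivlMr.
Unshelve. all: by end_near. Qed.

Lemma cvg_spec_prod (M : T -> 'M[R]_n) (M0 : 'M[R]_n) (v : T -> 'cV[R]_n)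
    (v0 : 'cV[R]_n) r :
  (forall t, (M t)^T = M t) -> M0^T = M0 -> all (fun p => 0 < p <= n)%N r ->
  M t @[t --> F] --> M0 -> v t @[t --> F] --> v0 ->
  spec_prod (M t) r (v t) @[t --> F] --> spec_prod M0 r v0.
Proof.
move=> Ms M0s rn MM0 vv0; elim: r rn => //= p r IH /andP[pn rn].
apply: cvgB; first exact: cvg_mulmx MM0 (IH rn).
by apply: cvgZ; [exact: cvg_lambda|exact: IH].
Qed.

End SpectralContinuity.

Section Mu.
Context {R : realType} {n : nat}.

Lemma iota2_valid m : (2 <= m <= n)%N ->
  all (fun p => 0 < p <= n)%N (iota 2 m.-1).
Proof. by move=> mn; apply/allP => p; rewrite mem_iota; lia. Qed.

Lemma compact_unit_eigenspan (M : 'M[R]_n) m : M^T = M -> (2 <= m <= n)%N ->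
  compact (unit_eigenspan M (nat_range 2 m)).
Proof.
move=> Ms mn.
have -> : unit_eigenspan M (nat_range 2 m) = [set v | sqnorm v = 1] `&`
    (fun v => sqnorm (spec_prod M (iota 2 m.-1) v)) @^-1` [set 0].
  apply/seteqP; split=> v /=; rewrite (unit_eigenspanP _ Ms mn).
    by move=> [-> ->]; rewrite /sqnorm big1// => i _; rewrite mxE expr0n.
  by move=> [-> /sqnorm_eq0].
apply: compact_closedI; first exact: compact_sphere.
apply: preimage_closed; last exact: closed_eq.
move=> v *; apply: (@cvg_sqnorm R _ (nbhs v)).
apply: (@cvg_spec_prod R _ (nbhs v) _ n (cst M) M id v) => //.
- exact: iota2_valid.
- exact: cvg_cst.
Qed.

Lemma unit_eigenspan_neq0 (M : 'M[R]_n) m : M^T = M -> (2 <= m <= n)%N ->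
  unit_eigenspan M (nat_range 2 m) !=set0.
Proof.
move=> Ms mn; have [Q eb] := eigenbasis_exists Ms.
have n1 : (1 < n)%N by lia.
have [u Lu] := eigenbasis_unit_eigenvector (Ordinal n1) eb.
exists (col (Ordinal n1) Q); split=> //.
exists [:: col (Ordinal n1) Q] => [w|].
  rewrite inE => /eqP ->; exists 2 => //=.
  by rewrite /nat_range /=; lia.
by rewrite memv_span// inE.
Qed.

(** Compactness of the unit eigenspan makes mu an attained minimum. *)
Lemma mu_spec N (L : 'cV[R]_N -> 'M[R]_n) m (x u : 'cV[R]_N) :
  (L x)^T = L x -> (2 <= m <= n)%N ->
  (exists2 v, unit_eigenspan (L x) (nat_range 2 m) v &
     mu L (nat_range 2 m) x u = qform (state_derivative L x u) v) /\
  (forall v, unit_eigenspan (L x) (nat_range 2 m) v ->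
     mu L (nat_range 2 m) x u <= qform (state_derivative L x u) v).
Proof.
move=> Ls mn; set B := state_derivative L x u.
have [||v Wv vmin] := @compact_EVT_min _ R (qform B) _ _
  (compact_unit_eigenspan Ls mn).
- exact: unit_eigenspan_neq0.
- apply: continuous_subspaceT => v.
  exact: (@cvg_qform R _ (nbhs v) _ n (cst B) id B v (cvg_cst _) cvg_id).
rewrite /mu /min_of -/B; case: xgetP => [c _ [[w Ww <-] clb]|].
  by split; [exists w | move=> z Wz; apply: clb; exists z].
move=> /(_ (qform B v)) [].
by split; [exists v => //; exact: set_mem|move=> _ [w Ww <-]; exact/vmin/mem_set].
Qed.

Lemma mu_geP N (L : 'cV[R]_N -> 'M[R]_n) m (x u : 'cV[R]_N) c :
  (L x)^T = L x -> (2 <= m <= n)%N ->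
  c <= mu L (nat_range 2 m) x u <->
  forall v, sqnorm v = 1 -> spec_prod (L x) (iota 2 m.-1) v = 0 ->
     c <= qform (state_derivative L x u) v.
Proof.
move=> Ls mn; have [[w Ww ->] h] := mu_spec u Ls mn; split=> [cw v v1 qv|].
  apply: le_trans (h v _); last exact/unit_eigenspanP.
  by have [[z _ ->] h'] := mu_spec u Ls mn; apply: le_trans cw _.
by apply; have /(unit_eigenspanP _ Ls mn)[] := Ww.
Qed.

End Mu.

(** * Derivatives of the Laplacian in the state *)

Section StateDerivative.
Context {R : realType} {N n : nat} (A : 'cV[R]_N -> 'M[R]_n).

Fact laplacian_linear : linear (@laplacian R n).
Proof.
move=> a B C; apply/matrixP => i j; rewrite /laplacian !mxE.
under eq_bigr do rewrite !mxE.
rewrite big_split /= -mulr_sumr.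
by case: (i == j); rewrite ?mulr1n ?mulr0n; ring.
Qed.

HB.instance Definition _ :=
  GRing.isLinear.Build R 'M[R]_n 'M[R]_n *:%R (@laplacian R n) laplacian_linear.

Lemma cvg_laplacian {T : Type} {F : set_system T} {FF : Filter F}
    (B : T -> 'M[R]_n) (B0 : 'M[R]_n) :
  B t @[t --> F] --> B0 -> laplacian (B t) @[t --> F] --> laplacian B0.
Proof.
move=> BB; apply: cvg_mxP => i j; rewrite /laplacian !mxE.
under eq_fun do rewrite !mxE.
apply: cvgB; last exact: cvg_coord.
by apply: cvgMn; apply: cvg_sumr => k _; apply: cvg_coord.
Qed.

Lemma laplacian_continuous : continuous (@laplacian R n).
Proof. move=> B; exact: (@cvg_laplacian _ (nbhs B) _ id B cvg_id). Qed.

Lemma laplacian_differentiable B : differentiable (@laplacian R n) B.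
Proof. exact: linear_differentiable laplacian_continuous. Qed.

Lemma d_laplacian B : 'd (@laplacian R n) B = @laplacian R n :> (_ -> _).
Proof. exact: diff_lin laplacian_continuous. Qed.

Lemma d_comp_laplacian x : differentiable A x ->
  'd (@laplacian R n \o A) x = @laplacian R n \o 'd A x :> (_ -> _).
Proof.
move=> dA; 
exact: (etrans (diff_comp dA (laplacian_differentiable (A x)))
  (congr1 (fun f => f \o 'd A x) (d_laplacian (A x)))).
Qed.

Lemma laplacian_C1 : continuously_differentiable A ->
  continuously_differentiable (fun x => laplacian (A x)).
Proof.
move=> [dA cA]; split=> [x|v].
  exact: (differentiable_comp (dA x) (laplacian_differentiable (A x))).
have dLE y : 'd (fun x => laplacian (A x)) y v = laplacian ('d A y v).
  exact: (congr1 (@^~ v) (d_comp_laplacian (dA y))).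
apply: (eq_ind_r (fun f => continuous f) _ (funext dLE)).
move=> x; exact: (cvg_laplacian (cA v x)).
Qed.

End StateDerivative.

Section ChainRule.
Context {R : realType} {N n : nat} (L : 'cV[R]_N -> 'M[R]_n).
Hypothesis LC1 : continuously_differentiable L.

(** The sum of partial derivatives is the differential, so that the chain rule
    applies to it. *)
Lemma state_derivativeE x u : state_derivative L x u = 'd L x u.
Proof.
have [dL _] := LC1.
have {2}-> : u = \sum_i u i 0 *: delta_mx i 0.
  rewrite [LHS]matrix_sum_delta; apply: eq_bigr => i _.
  by rewrite big_ord_recl big_ord0 addr0.
rewrite linear_sum /state_derivative; apply: eq_bigr => i _.
by rewrite linearZ /= deriveE.
Qed.

Lemma cvg_state_derivative {T : Type} {F : set_system T} {FF : Filter F}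
    (y u : T -> 'cV[R]_N) (x0 u0 : 'cV[R]_N) :
  y t @[t --> F] --> x0 -> u t @[t --> F] --> u0 ->
  state_derivative L (y t) (u t) @[t --> F] --> state_derivative L x0 u0.
Proof.
have [dL cL] := LC1; move=> yx uu; rewrite /state_derivative.
apply: cvg_big => [|i _]; first exact: add_continuous.
apply: cvgZ; first exact: cvg_coord.
rewrite deriveE//; under eq_fun do rewrite deriveE//.
exact: cvg_comp yx (cL _ _).
Qed.

Lemma derive_along (x : R -> 'cV[R]_N) (t : R) (w : 'cV[R]_N) :
  is_derive t (1 : R) x w ->
  is_derive t (1 : R) (L \o x) (state_derivative L (x t) w).
Proof.
move=> [dx xw]; have [dL _] := LC1; rewrite state_derivativeE.
have dfx : differentiable x t by apply/derivable1_diffP.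
have dLx : differentiable (L \o x) t by apply: differentiable_comp.
apply: DeriveDef; first exact: diff_derivable.
rewrite deriveE//.
have := congr1 (@^~ (1 : R)) (diff_comp dfx (dL (x t))) => /= ->.
by rewrite -xw deriveE.
Qed.

End ChainRule.

(** * Continuity of minimizers under varying constraints *)

Section Berge.
Context {R : realType} {N : nat} {X : Type} {F : set_system X} {FF : Filter F}.
Local Notation V := 'cV[R]_N.
Variables (U : X -> set V) (J : X -> V -> R) (k : X -> V).
Variables (Ux S : set V) (Jx : V -> R) (kx : V).

Lemma compact_norm_sphere (c : V) (r : R) : compact [set z : V | `|z - c| = r].
Proof.
apply: compact_cV.
  exists (r + `|c|); split; first exact: num_real.
  move=> x rx z /= zr; apply: le_trans (ltW rx); rewrite -zr.
  by rewrite -{1}(subrK c z) ler_normD.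
have -> : [set z : V | `|z - c| = r] = (fun z => `|z - c|) @^-1` [set r].
  by apply/seteqP; split.
apply: preimage_closed; last exact: closed_eq.
move=> z *; apply: (@cvg_norm _ _ _ (nbhs z)); apply: cvgB; first exact: cvg_id.
exact: cvg_cst.
Qed.

Hypothesis U_convex : forall y u v t, 0 <= t -> t <= 1 ->
  U y u -> U y v -> U y ((1 - t) *: u + t *: v).
Hypothesis J_convex : forall y u v t, 0 <= t -> t <= 1 ->
  J y ((1 - t) *: u + t *: v) <= Num.max (J y u) (J y v).
Hypothesis k_argmin : forall y, argmin (J y) (U y) (k y).
Hypothesis kx_unique : forall z, Ux z -> z != kx -> Jx kx < Jx z.
Hypothesis kx_adherent : forall e, 0 < e -> exists2 w, S w & `|w - kx| < e.
Hypothesis S_persistent : forall w, S w -> \forall y \near F, U y w.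
Hypothesis U_closed : forall z, ~ Ux z ->
  \forall z' \near z & y \near F, ~ U y z'.
Hypothesis J_cvg : forall z (e : R), 0 < e ->
  \forall z' \near z & y \near F, `|Jx z - J y z'| < e.
Hypothesis Jx_continuous : {for kx, continuous Jx}.

(** The limit problem is to minimize Jx over Ux, with minimizer kx and strictly
    feasible points S. On the sphere of radius e around kx, every point that is still
    feasible for y near the limit costs more than some c > Jx kx: this is a
    compactness argument on the sphere. Choose a strictly feasible w inside the
    sphere with cost below c. If k y were outside, the segment from w to k y would
    cross the sphere at a point that is feasible for y and costs at most
    max (J y w) (J y (k y)) = J y w < c. *)
Lemma berge : k y @[y --> F] --> kx.
Proof.
apply/cvgrPdist_lt => e e0.
have /compact_near_coveringP cov := @compact_norm_sphere kx e.
(* the level c is part of the limit, so that one covering of the sphere gives a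
   common c > Jx kx *)
have : filter_prod (nbhs (Jx kx)) F [set cy |
    [set z | `|z - kx| = e] `<=` [set z | ~ (U cy.2 z /\ J cy.2 z <= cy.1)]].
  apply: (cov (R * X)%type (filter_prod (nbhs (Jx kx)) F)
    (fun cy z => ~ (U cy.2 z /\ J cy.2 z <= cy.1))) => z /= ze.
  have [Uz|nUz] := pselect (Ux z).
    have zk : z != kx.
      by apply: contra_eq_neq ze => ->; rewrite subrr normr0 lt_eqF.
    have := kx_unique Uz zk; set a := Jx kx; set b := Jx z => ab.
    have d0 : 0 < (b - a) / 2 by rewrite divr_gt0// subr_gt0.
    have hc : \forall c \near a, `|a - c| < (b - a) / 2.
      by apply: filterS (nbhsx_ballx a _ d0) => c; rewrite -ball_normE.
    have [[Z Y] /= [nZ FY] ZY] := J_cvg z d0.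
    exists (Z, [set cy | `|a - cy.1| < (b - a) / 2 /\ Y cy.2]) => /=.
      split=> //; exists ([set c | `|a - c| < (b - a) / 2], Y) => //.
    move=> [z' [c y]] /= [Zz' [ac Yy]] [_ Jc].
    have /= := ZY (z', y) (conj Zz' Yy); rewrite -/b => bJ.
    have := ltr_norml (b - J y z') ((b - a) / 2); rewrite bJ.
    have := ltr_norml (a - c) ((b - a) / 2); rewrite ac.
    move=> /esym/andP[h1 h2] /esym/andP[h3 h4].
    lra.
  have [[Z Y] /= [nZ FY] ZY] := U_closed nUz.
  exists (Z, [set cy | Y cy.2]) => /=.
    split=> //; exists (setT, Y) => [|[? ?] []//].
    by split=> //; exact: filterT.
  move=> [z' [c y]] /= [Zz' Yy] [Uy _].
  exact: (ZY (z', y) (conj Zz' Yy)).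
move=> [[C Y] /= [nC FY] CY].
have [c [ac Cc]] : exists c, Jx kx < c /\ C c.
  have /nbhs_ballP[r /= r0 rC] := nC.
  exists (Jx kx + r / 2); split; first by rewrite ltrDl divr_gt0.
  apply: rC; rewrite /ball /= opprD addrA subrr add0r normrN gtr0_norm ?divr_gt0//.
  by rewrite ltr_pdivrMr// ltr_pMr// ltr1n.
have [w [Sw we Jw]] : exists w, [/\ S w, `|w - kx| < e & Jx w < c].
  have : \forall w \near kx, Jx w < c.
    exact: (@cvgr_lt R V (nbhs kx) _ Jx (Jx kx) Jx_continuous c ac).
  move=> /nbhs_ballP[r /= r0 rC].
  have me : 0 < Num.min r e by rewrite lt_min r0 e0.
  have [w Sw] := kx_adherent me; rewrite lt_min => /andP[wr we].
  by exists w; split=> //; apply: rC; rewrite -ball_normE /= distrC.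
have UwF : \forall y \near F, U y w by exact: S_persistent.
have JwF : \forall y \near F, J y w < c.
  have d0 : 0 < c - Jx w by rewrite subr_gt0.
  have [[Z Y'] /= [nZ FY'] ZY] := J_cvg w d0.
  apply: filterS FY' => y Yy.
  have := ZY (w, y) (conj (nbhs_singleton nZ) Yy) => /=.
  rewrite ltr_norml => /andP[h1 h2]; lra.
near=> y.
have Uw : U y w by near: y.
have Jyw : J y w < c by near: y.
have Yy : Y y by near: y.
rewrite ltNge; apply/negP => ek.
pose f t : R := `|((1 - t) *: w + t *: k y) - kx|.
have cf : continuous f.
  move=> t; apply: (@cvg_norm _ _ _ (nbhs t)); apply: cvgB; last exact: cvg_cst.
  apply: cvgD; apply: cvgZr_tmp.
    by apply: cvgB; [exact: cvg_cst|exact: cvg_id].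
  exact: cvg_id.
have [|||t t01 fte] := @IVT R f 0 1 e.
- exact: ler01.
- by apply: continuous_subspaceT.
- rewrite /f subr0 scale1r scale0r addr0 subrr scale0r add0r scale1r.
  rewrite distrC in ek.
  by rewrite ge_min (ltW we) /= le_max ek orbT.
have /andP[t0 t1] : 0 <= t <= 1 by rewrite in_itv /= in t01.
have [Uk kmin] := k_argmin y.
apply: (CY (c, y) (conj Cc Yy) _ fte); split=> /=; first exact: U_convex.
apply: le_trans (J_convex y w (k y) t0 t1) _; rewrite ge_max (ltW Jyw) /=.
exact: le_trans (kmin _ Uw) (ltW Jyw).
Unshelve. all: by end_near. Qed.

End Berge.

(** * Feasible inputs as the state varies *)

Section Convexity.
Context {R : realType} {N : nat}.

Lemma convex_function_segment (f : 'cV[R]_N -> R) : convex_function setT f ->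
  forall u v t, 0 <= t -> t <= 1 ->
    f ((1 - t) *: u + t *: v) <= (1 - t) * f u + t * f v.
Proof.
move=> cf u v t t0 t1.
rewrite addrC [leRHS]addrC.
exact: (cf (Itv01 t0 t1) v u (mem_set I) (mem_set I)).
Qed.

Lemma strictly_convex_le_max (f : 'cV[R]_N -> R) : strictly_convex f ->
  forall u v t, 0 <= t -> t <= 1 ->
    f ((1 - t) *: u + t *: v) <= Num.max (f u) (f v).
Proof.
move=> cf u v t; rewrite le_eqVlt => /predU1P[<- _|t0].
  by rewrite subr0 scale1r scale0r addr0 le_max lexx.
rewrite le_eqVlt => /predU1P[->|t1].
  by rewrite subrr scale1r scale0r add0r le_max lexx orbT.
have [->|uv] := eqVneq u v.
  by rewrite -scalerDl subrK scale1r le_max lexx.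
rewrite eq_sym in uv; have := cf v u t uv t0 t1.
rewrite addrC => /ltW /le_trans; apply.
set m := Num.max _ _.
have h1 : f u <= m by rewrite le_max lexx.
have h2 : f v <= m by rewrite le_max lexx orbT.
have : t * f v <= t * m by rewrite ler_wpM2l// ltW.
have : (1 - t) * f u <= (1 - t) * m by rewrite ler_wpM2l// subr_ge0 ltW.
lra.
Qed.

Lemma strictly_convex_argmin_unique (f : 'cV[R]_N -> R) U u v :
  strictly_convex f -> argmin f U u ->
  (forall u v t, 0 <= t -> t <= 1 -> U u -> U v -> U ((1 - t) *: u + t *: v)) ->
  U v -> v != u -> f u < f v.
Proof.
move=> cf [Uu umin] Uc Uv vu; rewrite lt_neqAle umin// andbT.
apply/eqP => fuv; have h2 : (0 : R) < 2^-1 by rewrite invr_gt0.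
have h1 : (2^-1 : R) < 1 by rewrite invf_lt1// ltr1n.
have := umin _ (Uc _ _ _ (ltW h2) (ltW h1) Uu Uv).
by have := cf v u _ vu h2 h1; rewrite fuv addrC => h3 h4; lra.
Qed.

End Convexity.

Section SpecSurj.
Context {R : realType} {n : nat}.

(** Bezout in coordinates: on the kernel of the first product only eigenvalues of
    r1 occur, so no factor of the second product vanishes there. *)
Lemma spec_prod_surj (M : 'M[R]_n) r1 r2 v : M^T = M ->
  (forall p q, p \in r1 -> q \in r2 -> lambda M p != lambda M q) ->
  spec_prod M r1 v = 0 -> exists w, spec_prod M r2 w = v.
Proof.
move=> Ms dis v0; have [Q eb] := eigenbasis_exists Ms.
pose f (i : 'I_n) := \prod_(p <- r2) (lambda M i.+1 - lambda M p).
exists (Q *m \col_i ((Q^T *m v) i 0 / f i)).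
apply: (eigenbasis_coord_inj eb) => i; rewrite (spec_prod_coord _ _ _ eb) -/(f i).
rewrite mulmxA eb.1 mul1mx [X in f i * X]mxE.
have [fi0|fi0] := eqVneq (f i) 0; last by rewrite mulrC divfK.
rewrite fi0 mul0r; apply/esym.
have := spec_prod_coord r1 v i eb; rewrite v0 mulmx0 [LHS]mxE => /esym/eqP.
rewrite mulf_eq0 => /orP[|/eqP//]; rewrite prodf_seq_eq0 => /hasP[p pr1] /=.
move: fi0 => /eqP; rewrite prodf_seq_eq0 => /hasP[q qr2] /=.
rewrite !subr_eq0 => /eqP e1 /eqP e2; have := dis p q pr1 qr2.
by rewrite -e1 -e2 eqxx.
Qed.

End SpecSurj.

Section FeasibleSet.
Context {R : realType} {N n : nat} (L : 'cV[R]_N -> 'M[R]_n).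
Variables (alpha : R -> R) (eps : R).
Hypothesis LC1 : continuously_differentiable L.
Hypothesis Lsym : forall x, (L x)^T = L x.
Hypothesis alpha_continuous : continuous alpha.

Lemma mu_ge_hom m (x u : 'cV[R]_N) (c : R) : (2 <= m <= n)%N ->
  c <= mu L (nat_range 2 m) x u ->
  forall v, spec_prod (L x) (iota 2 m.-1) v = 0 ->
    c * sqnorm v <= qform (state_derivative L x u) v.
Proof.
move=> mn /(mu_geP u c (Lsym x) mn) h v qv.
have [->|v0] := eqVneq v 0.
  by rewrite -(scale0r (0 : 'cV[R]_n)) sqnormZ qformZ expr0n /= !mul0r mulr0.
have := h _ (unit_normalize v0); rewrite spec_prodZ qv scaler0 => /(_ erefl).
rewrite qformZ exprVn sqr_sqrtr ?sqnorm_ge0// [leRHS]mulrC.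
by rewrite ler_pdivlMr// sqnorm_gt0.
Qed.

Lemma state_derivative_segment (x u v : 'cV[R]_N) t :
  state_derivative L x ((1 - t) *: u + t *: v) =
  (1 - t) *: state_derivative L x u + t *: state_derivative L x v.
Proof.
rewrite /state_derivative !scaler_sumr -big_split; apply: eq_bigr => i _ /=.
by rewrite !mxE !scalerA -scalerDl.
Qed.

(** The form is affine in the input, so its minimum over v is concave in the
    input; strictness survives because the minimum is attained. *)
Lemma mu_segment_gt m x u v t c : (2 <= m <= n)%N -> 0 < t -> t <= 1 ->
  c <= mu L (nat_range 2 m) x u -> c < mu L (nat_range 2 m) x v ->
  c < mu L (nat_range 2 m) x ((1 - t) *: u + t *: v).
Proof.
move=> mn t0 t1 cu cv.
have [[w Ww ->] _] := mu_spec ((1 - t) *: u + t *: v) (Lsym x) mn.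
have [_ /(_ w Ww) hu] := mu_spec u (Lsym x) mn.
have [_ /(_ w Ww) hv] := mu_spec v (Lsym x) mn.
rewrite state_derivative_segment qformD !qformZl.
have := ler_wpM2l (_ : 0 <= 1 - t) (le_trans cu hu); rewrite subr_ge0 => /(_ t1).
have := lt_le_trans cv hv; rewrite -(ltr_pM2l t0); lra.
Qed.

Lemma U_range_convex m x u v t : (2 <= m <= n)%N -> 0 <= t -> t <= 1 ->
  U_range L alpha eps m x u -> U_range L alpha eps m x v ->
  U_range L alpha eps m x ((1 - t) *: u + t *: v).
Proof.
move=> mn t0 t1; rewrite /U_range /=; set c := - alpha _ => cu cv.
apply/(mu_geP _ _ (Lsym x) mn) => w w1 qw.
have /(mu_geP _ _ (Lsym x) mn)/(_ w w1 qw) hu := cu.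
have /(mu_geP _ _ (Lsym x) mn)/(_ w w1 qw) hv := cv.
rewrite state_derivative_segment qformD !qformZl.
have := ler_wpM2l (_ : 0 <= 1 - t) hu; rewrite subr_ge0 => /(_ t1).
have := ler_wpM2l t0 hv; lra.
Qed.

Lemma L_continuous : continuous L.
Proof. by move=> x; apply: differentiable_continuous; case: LC1. Qed.

Lemma cvg_threshold {T : Type} {F : set_system T} {FF : Filter F}
    (y : T -> 'cV[R]_N) x m : (0 < m <= n)%N -> y t @[t --> F] --> x ->
  alpha (lambda (L (y t)) m - eps) @[t --> F] --> alpha (lambda (L x) m - eps).
Proof.
move=> mn yx; apply: (cvg_comp (fun t => lambda (L (y t)) m - eps) alpha _
  (@alpha_continuous _)).
apply: cvgB; last exact: cvg_cst.
by apply: cvg_lambda => //; exact: cvg_comp yx (@L_continuous x).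
Qed.

(** At a unit vector v outside the kernel at x, nearby vectors are outside the
    kernels at nearby states; at a v inside, the inequality holds with a margin.
    Compactness of the sphere makes the neighbourhood of x uniform in v. *)
Lemma strict_feasibility_persists m x w : (2 <= m <= n)%N ->
  - alpha (lambda (L x) m - eps) < mu L (nat_range 2 m) x w ->
  \forall y \near x, U_range L alpha eps m y w.
Proof.
move=> mn hw; have mn' : (0 < m <= n)%N by lia.
have /compact_near_coveringP cov := @compact_sphere R n.
have : \forall y \near x, [set v | sqnorm v = 1] `<=` [set v |
    spec_prod (L y) (iota 2 m.-1) v = 0 ->
    - alpha (lambda (L y) m - eps) <= qform (state_derivative L y w) v].
  apply: (cov 'cV[R]_N (nbhs x) (fun y v =>
    spec_prod (L y) (iota 2 m.-1) v = 0 ->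
    - alpha (lambda (L y) m - eps) <= qform (state_derivative L y w) v)) => v v1.
  have Lx2 : L t.2 @[t --> filter_prod (nbhs v) (nbhs x)] --> L x.
    exact: (@cvg_comp _ _ _ snd L _ (nbhs x) _ cvg_snd (@L_continuous x)).
  have [qv|qv] := eqVneq (spec_prod (L x) (iota 2 m.-1) v) 0.
    have Wv : unit_eigenspan (L x) (nat_range 2 m) v by exact/unit_eigenspanP.
    have [_ /(_ v Wv) hv] := mu_spec w (Lsym x) mn.
    have : qform (state_derivative L t.2 w) t.1 + alpha (lambda (L t.2) m - eps)
      @[t --> filter_prod (nbhs v) (nbhs x)] -->
      qform (state_derivative L x w) v + alpha (lambda (L x) m - eps).
      apply: cvgD.
        apply: cvg_qform; last exact: cvg_fst.
        apply: cvg_state_derivative => //; [exact: cvg_snd|exact: cvg_cst].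
      by apply: cvg_threshold => //; exact: cvg_snd.
    move=> /cvgr_gt/(_ 0)/(_ _)[|]; first by move: (lt_le_trans hw hv); lra.
    move=> V Vn VP; exists V => // t /VP /= h _; lra.
  have : sqnorm (spec_prod (L t.2) (iota 2 m.-1) t.1)
      @[t --> filter_prod (nbhs v) (nbhs x)] -->
      sqnorm (spec_prod (L x) (iota 2 m.-1) v).
    apply: cvg_sqnorm; apply: cvg_spec_prod => //; first exact: iota2_valid.
    exact: cvg_fst.
  move=> /cvgr_gt/(_ 0)/(_ (sqnorm_gt0 qv))[V Vn VP].
  exists V => // t /VP /= h q0; move: h; rewrite q0 /sqnorm big1 ?ltxx// => i _.
  by rewrite mxE expr0n.
apply: filterS => y hy; apply/(mu_geP _ _ (Lsym y) mn) => v v1 qv.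
exact: hy.
Qed.

Hypothesis L1_le0 : forall x, lambda (L x) 1 <= 0.

(** The conclusion concerns all constraints together: the one violated near x may
    have an index M larger than m, the end of the cluster of lambda_m. *)
Lemma infeasibility_persists m x z : (2 <= m <= n)%N ->
  0 < lambda (L x) 2 -> ~ U_range L alpha eps m x z ->
  \forall z' \near z & y \near x, ~ U_agg L alpha eps y z'.
Proof.
move=> mn l2 nz.
have [M [mM Mn lM lt]] : exists M, [/\ (m <= M)%N, (M <= n)%N,
    lambda (L x) M = lambda (L x) m &
    forall p, (M < p <= n)%N -> lambda (L x) m < lambda (L x) p].
  pose P p := (p <= n)%N && (lambda (L x) p == lambda (L x) m).
  have exP : exists p, P p by exists m; rewrite /P eqxx andbT; lia.
  have ubP p : P p -> (p <= n)%N by case/andP.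
  case: (ex_maxnP exP ubP) => M /andP[Mn /eqP lM] Mmax.
  have mM : (m <= M)%N by apply: Mmax; rewrite /P eqxx andbT; lia.
  exists M; split=> //.
  move=> p /andP[Mp pn]; rewrite lt_neqAle; apply/andP; split.
    apply/negP => lmp; have : (p <= M)%N by apply: Mmax; rewrite /P pn eq_sym.
    by lia.
  by rewrite -lM lambda_mono//; lia.
have Mn2 : (2 <= M <= n)%N by lia.
(* the factors left out by the constraint of index M; none of their eigenvalues at
   x lies between lambda_2 and lambda_m *)
pose rc := 1%N :: iota M.+1 (n - M).
have [v [v1 qv vlt]] : exists v, [/\ sqnorm v = 1,
    spec_prod (L x) (iota 2 m.-1) v = 0 &
    qform (state_derivative L x z) v < - alpha (lambda (L x) m - eps)].
  apply: contrapT => h; apply: nz; apply/(mu_geP _ _ (Lsym x) mn) => v v1 qv.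
  by rewrite leNgt; apply/negP => vlt; apply: h; exists v.
have [|w wv] := spec_prod_surj (r2 := rc) (Lsym x) _ qv.
  move=> p q; rewrite mem_iota inE => pm /orP[/eqP->|]; last first.
    rewrite mem_iota => qM; rewrite lt_eqF//.
    apply: (@le_lt_trans _ _ (lambda (L x) m)); last by apply: lt; lia.
    by apply: lambda_mono => //; lia.
  rewrite gt_eqF//; apply: le_lt_trans (L1_le0 x) _; apply: lt_le_trans l2 _.
  by apply: lambda_mono => //; lia.
have rcn : all (fun p => 0 < p <= n)%N rc.
  by apply/allP => p; rewrite inE mem_iota => /orP[/eqP->|]; lia.
(* the violation of the homogeneous form of the constraint by the moved vector *)
pose f (t : 'cV[R]_N * 'cV[R]_N) :=
  qform (state_derivative L t.2 t.1) (spec_prod (L t.2) rc w) +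
  alpha (lambda (L t.2) M - eps) * sqnorm (spec_prod (L t.2) rc w).
have Lx2 : L t.2 @[t --> filter_prod (nbhs z) (nbhs x)] --> L x.
  exact: (@cvg_comp _ _ _ snd L _ (nbhs x) _ cvg_snd (@L_continuous x)).
have vy : spec_prod (L t.2) rc w @[t --> filter_prod (nbhs z) (nbhs x)] --> v.
  by rewrite -wv; apply: cvg_spec_prod => //; exact: cvg_cst.
have : f t @[t --> filter_prod (nbhs z) (nbhs x)] -->
    qform (state_derivative L x z) v + alpha (lambda (L x) M - eps) * sqnorm v.
  apply: cvgD.
    apply: cvg_qform => //.
    by apply: cvg_state_derivative => //; [exact: cvg_snd|exact: cvg_fst].
  apply: cvgM; last exact: cvg_sqnorm.
  by apply: cvg_threshold; [lia|exact: cvg_snd].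
move=> /cvgr_lt/(_ 0)/(_ _)[|V Vn VP]; first by rewrite v1 lM; lra.
exists V => // t /VP /= ft Uz.
have q0 : spec_prod (L t.2) (iota 2 M.-1) (spec_prod (L t.2) rc w) = 0.
  apply: spec_prod_complement => // i i0.
  by rewrite inE !mem_iota; lia.
have := mu_ge_hom Mn2 (Uz M Mn2) q0.
by rewrite /f in ft; move=> h; lra.
Qed.

End FeasibleSet.

(** * Continuity of the controller *)

Lemma cvg_uncurry (V1 V2 W : topologicalType) (h : V1 -> V2 -> W) :
  continuous (fun z : V1 * V2 => h z.1 z.2) ->
  forall (T : Type) (F : set_system T) (FF : Filter F) (a : T -> V1) (b : T -> V2)
    (x : V1) (z : V2),
  a t @[t --> F] --> x -> b t @[t --> F] --> z ->
  h (a t) (b t) @[t --> F] --> h x z.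
Proof.
move=> hc T F FF a b x z ax bz.
exact: (@cvg_comp _ _ _ (fun t => (a t, b t)) (fun z => h z.1 z.2) _ _ _
  (cvg_pair ax bz) (hc (x, z))).
Qed.

Section Controller.
Context {R : realType} {N n dnom : nat} (L : 'cV[R]_N -> 'M[R]_n).
Variables (alpha : R -> R) (eps : R).
Variables (J : 'cV[R]_N -> 'cV[R]_N -> R) (g : 'cV[R]_N -> 'cV[R]_N -> 'cV[R]_dnom).
Variable (k : 'cV[R]_N -> 'cV[R]_N).
Hypothesis LC1 : continuously_differentiable L.
Hypothesis Lsym : forall x, (L x)^T = L x.
Hypothesis L1_le0 : forall x, lambda (L x) 1 <= 0.
Hypothesis alpha_continuous : continuous alpha.
Hypothesis J_continuous : continuous (fun z : 'cV[R]_N * 'cV[R]_N => J z.1 z.2).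
Hypothesis J_convex : forall x, strictly_convex (J x).
Hypothesis g_continuous : continuous (fun z : 'cV[R]_N * 'cV[R]_N => g z.1 z.2).
Hypothesis g_convex : forall x i, convex_function setT (fun u => g x u i 0).
Let U x := U_agg L alpha eps x `&` U_nom g x.
Let S x := [set u | (forall m, (2 <= m <= n)%N ->
    - alpha (lambda (L x) m - eps) < mu L (nat_range 2 m) x u) /\
   (forall i, g x u i 0 < 0)].
Hypothesis strictly_feasible : forall x, S x !=set0.
Hypothesis k_argmin : forall x, argmin (J x) (U x) (k x).

Lemma feasible_convex x (u v : 'cV[R]_N) (t : R) : 0 <= t -> t <= 1 ->
  U x u -> U x v -> U x ((1 - t) *: u + t *: v).
Proof.
move=> t0 t1 [Uu gu] [Uv gv]; split=> [m mn|i].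
  by apply: U_range_convex => //; [exact: Uu|exact: Uv].
apply: le_trans (convex_function_segment (@g_convex x i) u v t0 t1) _.
have := ler_wpM2l t0 (gv i); have := ler_wpM2l (_ : 0 <= 1 - t) (gu i).
by rewrite subr_ge0 => /(_ t1); lra.
Qed.

(** A short way from u towards a strictly feasible input. *)
Lemma strictly_feasible_adherent x u e : U x u -> 0 < e ->
  exists2 w, S x w & `|w - u| < e.
Proof.
move=> [Uu gu] e0; have [v [Sv gv]] := strictly_feasible x.
have d0 : 0 < `|v - u| + 1 by rewrite ltr_wpDl.
pose t := Num.min 1 (e / (`|v - u| + 1)).
have t0 : 0 < t by rewrite lt_min ltr01 divr_gt0.
have t1 : t <= 1 by rewrite ge_min lexx.
have te : t <= e / (`|v - u| + 1) by rewrite ge_min lexx orbT.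
exists ((1 - t) *: u + t *: v); first split=> [m mn|i].
- by apply: mu_segment_gt => //; [exact: Uu|exact: Sv].
- apply: le_lt_trans (convex_function_segment (@g_convex x i) u v (ltW t0) t1) _.
  have h : t * g x v i 0 < 0 by rewrite pmulr_rlt0.
  have := ler_wpM2l (_ : 0 <= 1 - t) (gu i).
  by rewrite subr_ge0 => /(_ t1); lra.
have -> : (1 - t) *: u + t *: v - u = t *: (v - u).
  by apply/colP => i; rewrite !mxE; ring.
rewrite normrZ gtr0_norm//.
apply: le_lt_trans (_ : e / (`|v - u| + 1) * `|v - u| < e).
  by rewrite ler_wpM2r.
by rewrite mulrAC -mulrA gtr_pMr// ltr_pdivrMr// mul1r ltrDl.
Qed.

Lemma controller_continuous : 0 < eps -> {within C_set L eps, continuous k}.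
Proof.
move=> eps0; apply/subspace_continuousP => x xC.
have l2 : 0 < lambda (L x) 2 by apply: lt_le_trans eps0 xC.
set F := within _ _; have FF : Filter F by exact: within_filter.
have Fx : nbhs x `<=` F by move=> V; apply: filterS => y Vy _.
have fp (z : 'cV[R]_N) (V : set ('cV[R]_N * 'cV[R]_N)) :
    filter_prod (nbhs z) (nbhs x) V -> filter_prod (nbhs z) F V.
  by move=> [[V1 V2] [h1 h2] h]; exists (V1, V2) => //; split=> //; exact: Fx.
apply: (@berge R N _ F FF U J k (U x) (S x) (J x) (k x)).
- by move=> y u v t; exact: feasible_convex.
- by move=> y u v t; exact: strictly_convex_le_max.
- exact: k_argmin.
- move=> z Uz zk; apply: (strictly_convex_argmin_unique _ (k_argmin x)) => //.
  by move=> *; exact: feasible_convex.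
- by move=> e; apply: strictly_feasible_adherent; case: (k_argmin x).
- move=> w [Sw gw]; apply: Fx.
  have gF : \forall y \near x, forall i, g y w i 0 < 0.
    apply: (@filter_forall _ _ (fun i y => g y w i 0 < 0) (nbhs x) _) => i.
    have : g y w i 0 @[y --> x] --> g x w i 0.
      apply: cvg_coord.
      exact: (@cvg_uncurry _ _ _ _ g_continuous _ (nbhs x) _ id (cst w) x w
        cvg_id (cvg_cst w)).
    by move=> /cvgr_lt/(_ 0)/(_ (gw i)).
  have SF : \forall y \near x, forall m : 'I_n.+1, (2 <= m)%N ->
      U_range L alpha eps m y w.
    apply: (@filter_forall _ _ (fun (m : 'I_n.+1) y => (2 <= m)%N ->
      U_range L alpha eps m y w) (nbhs x) _) => m; have [m2|m2] := leqP 2 m; last first.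
      by near=> y => h; exfalso; lia.
    have mn : (2 <= m <= n)%N by have := ltn_ord m; lia.
    have := strict_feasibility_persists LC1 Lsym alpha_continuous mn (Sw _ mn).
    by apply: filterS => y ? _.
  near=> y; split=> [m mn|i]; last by rewrite ltW//; move: i; near: y.
  have mn' : (m < n.+1)%N by move: mn => /andP[].
  have m2 : (2 <= Ordinal mn')%N by move: mn => /andP[].
  suff : forall m : 'I_n.+1, (2 <= m)%N -> U_range L alpha eps m y w.
    by move=> /(_ (Ordinal mn') m2).
  by near: y.
- move=> z nUz; have [Uz|nz] := pselect (U_agg L alpha eps x z).
    have [i gi] : exists i, 0 < g x z i 0.
      apply: contrapT => h; apply: nUz; split=> // i.
      by rewrite leNgt; apply/negP => gi; apply: h; exists i.
    apply: fp.
    have : g t.2 t.1 i 0 @[t --> filter_prod (nbhs z) (nbhs x)] --> g x z i 0.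
      apply: cvg_coord.
      by apply: (cvg_uncurry g_continuous); [exact: cvg_snd|exact: cvg_fst].
    move=> /cvgr_gt/(_ 0)/(_ gi); apply: filterS => t /= gt [_ /(_ i)].
    by rewrite leNgt gt.
  have [m [mn nm]] : exists m, (2 <= m <= n)%N /\ ~ U_range L alpha eps m x z.
    apply: contrapT => h; apply: nz => m mn; apply: contrapT => nm; apply: h.
    by exists m.
  apply: fp; have := infeasibility_persists LC1 Lsym alpha_continuous L1_le0 mn l2 nm.
  move=> [V nV hV]; exists V => // t Vt Ut.
  exact: (hV t Vt) Ut.1.
- move=> z e e0; apply: fp.
  have : J t.2 t.1 @[t --> filter_prod (nbhs z) (nbhs x)] --> J x z.
    by apply: (cvg_uncurry J_continuous); [exact: cvg_snd|exact: cvg_fst].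
  by move=> /cvgrPdist_lt/(_ _ e0).
- exact: (@cvg_uncurry _ _ _ _ J_continuous _ (nbhs (k x)) _ (cst x) id x (k x)
    (cvg_cst x) cvg_id).
Unshelve. all: by end_near. Qed.

End Controller.

(** * Monotonicity of absolutely continuous functions *)

Section AbsoluteContinuity.
Context {R : realType} {N : nat}.
Implicit Types (a b : R) (f : R -> 'cV[R]_N).

Lemma ac_uniformly_continuous a b f : absolutely_continuous a b f ->
  forall e, 0 < e -> exists2 d, 0 < d & forall s t, a <= s <= b -> a <= t <= b ->
    `|s - t| < d -> `|f s - f t| < e.
Proof.
move=> acf e e0; have [d d0 hd] := acf e e0; exists d => // s t sab tab std.
wlog st : s t sab tab std / s <= t.
  move=> h; have [|/ltW] := leP s t; first exact: h.
  by rewrite distrC; apply: h => //; rewrite distrC.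
have := hd [:: (s, t)]; rewrite !big_seq1 /= distrC => -> //.
  by move=> J; rewrite inE => /eqP -> /=; move: sab tab => /andP[? _] /andP[_ ?].
by rewrite distrC ger0_norm ?subr_ge0 in std.
Qed.

Lemma ac_bounded a b f : absolutely_continuous a b f ->
  exists2 r : R, 0 <= r & forall t, a <= t <= b -> `|f t| <= r.
Proof.
move=> acf; have cf : {within `[a, b], continuous f}.
  apply/subspace_continuousP => t /=; rewrite in_itv /= => tab.
  apply/cvgrPdist_lt => e e0.
  have [d d0 hd] := ac_uniformly_continuous acf e0.
  have : \forall s \near t, `|t - s| < d.
    by apply: filterS (nbhsx_ballx t _ d0) => s; rewrite -ball_normE.
  by apply: filterS => s tsd sab; apply: hd => //; rewrite /= in_itv in sab.
have /compact_bounded[M [_ hM]] := continuous_compact cf (@segment_compact _ a b).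
exists (`|M| + 1) => [|t tab]; first by rewrite addr_ge0.
apply: (hM (`|M| + 1)); first by rewrite (le_lt_trans (ler_norm _))// ltrDl.
by exists t => //=; rewrite in_itv.
Qed.

Lemma measure_open_segment (U : set R) (a t t' : R) : open U -> a <= t -> t <= t' ->
  `]t, t'] `<=` U ->
  (lebesgue_measure (U `&` `]a, t']) =
   lebesgue_measure (U `&` `]a, t]) + (t' - t)%:E)%E.
Proof.
move=> oU at_ tt' tU.
have -> : U `&` `]a, t'] = (U `&` `]a, t]) `|` `]t, t'].
  apply/seteqP; split=> s /=; rewrite !in_itv /=.
    by move=> [Us /andP[as_ st']]; have [st|ts] := leP s t;
      [left; rewrite as_|right].
  move=> [[Us /andP[as_ st]]|/andP[ts st']].
    by rewrite as_ (le_trans st).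
  by split; [apply: tU; rewrite /= in_itv /= ts|rewrite (le_lt_trans at_)].
rewrite measureU/=.
- congr (_ + _)%E; rewrite lebesgue_measure_itv /= lte_fin.
  case: ltP => [_|t't]; first by rewrite EFinB.
  have -> : t' = t by apply: le_anti; rewrite t't tt'.
  by rewrite subrr.
- by apply: measurableI => //; exact: measurable_realfun.open_measurable.
- by [].
- apply/seteqP; split=> s //=; rewrite !in_itv /= => -[[_ /andP[_ st]] /andP[ts _]].
  by move: (le_lt_trans st ts); rewrite ltxx.
Qed.

(** Cover the exceptional null set by an open U of measure below the modulus of
    absolute continuity for e. Every point t has a neighbourhood in which an
    interval ending at t is either good (h loses at most e times its length) or
    contained in U. Going through [a, b] by such intervals (Cousin's lemma, proved
    here by a supremum), the good ones lose at most e (b - a) altogether, and the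
    others, of total length at most the measure of U, at most e. *)
Lemma ac_nondecreasing a b f (h : R -> R) (K : R) (B : set R) :
  a <= b -> absolutely_continuous a b f -> 0 <= K ->
  (forall s t, a <= s <= b -> a <= t <= b -> `|h s - h t| <= K * `|f s - f t|) ->
  lebesgue_measure.-negligible B ->
  (forall t, a <= t <= b -> ~ B t -> forall e, 0 < e -> \forall s \near t,
     a <= s <= b -> (t <= s -> - (e * (s - t)) <= h s - h t) /\
                    (s <= t -> - (e * (t - s)) <= h t - h s)) ->
  h a <= h b.
Proof.
move=> ab acf K0 hf [B' [mB' B'0 BB']] hB.
suff key e : 0 < e -> - (e * (b - a)) - e <= h b - h a.
  rewrite leNgt; apply/negP => hab.
  have d0 : 0 < b - a + 1 by rewrite ltr_wpDl// subr_ge0.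
  have e0 : 0 < (h a - h b) / (2 * (b - a + 1)).
    by rewrite divr_gt0 ?mulr_gt0// subr_gt0.
  have := key _ e0; set e := _ / _.
  have : e * (2 * (b - a + 1)) = h a - h b by rewrite divfK// gt_eqF// mulr_gt0.
  by move: e0; rewrite -/e => e0; nra.
move=> e0; have K1 : 0 < K + 1 by rewrite ltr_wpDl.
have [d d0 hd] := acf (e / (K + 1)) (divr_gt0 e0 K1).
have [|U [oU B'U Ud]] := lebesgue_regularity_outer mB' _ d0.
  exact: (eq_ind_r (fun z => z < +oo)%E (ltry 0) B'0).
have mU : (lebesgue_measure U < d%:E)%E.
  rewrite (_ : U = (U `\` B') `|` B'); last first.
    by rewrite setUC setDUK.
  have mUB : measurable (U `\` B').
    by apply: measurableD => //; exact: measurable_realfun.open_measurable.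
  apply: le_lt_trans (measureU2 lebesgue_measure mUB mB') _.
  apply: le_lt_trans Ud; rewrite -[leRHS]adde0; apply: leeD => //.
  by move/eqP: B'0; rewrite eq_le => /andP[].
(* t is reached from a, with s the list of the intervals inside U used so far *)
pose P t := exists s : seq (R * R),
  [/\ (forall I, I \in s -> [/\ a <= I.1, I.1 <= I.2 & I.2 <= t]),
      pairwise [rel I K | (I.2 <= K.1) || (K.2 <= I.1)] s,
      ((\sum_(I <- s) (I.2 - I.1))%:E <= lebesgue_measure (U `&` `]a, t]))%E &
      - (e * (t - a)) - \sum_(I <- s) `|h I.2 - h I.1| <= h t - h a].
have Pa : P a.
  exists [::]; split=> //; first by rewrite big_nil.
  by rewrite big_nil !subrr mulr0 oppr0 addr0.
have step t t' : P t -> a <= t -> t <= t' ->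
    - (e * (t' - t)) <= h t' - h t \/ `]t, t'] `<=` U -> P t'.
  move=> [s [sab spw slen sh]] at_ tt' [good|bad].
    exists s; split=> //.
    - by move=> I /sab[? ? It]; split=> //; exact: le_trans It tt'.
    - apply: le_trans slen _; apply: le_measure.
      + by rewrite inE; apply: measurableI => //; exact: measurable_realfun.open_measurable.
      + by rewrite inE; apply: measurableI => //; exact: measurable_realfun.open_measurable.
      + apply: setIS => r /=; rewrite !in_itv /= => /andP[-> rt] /=.
        exact: le_trans rt tt'.
    - by lra.
  exists ((t, t') :: s); split.
  - move=> I; rewrite inE => /predU1P[->//|/sab[? ? It]].
    by split=> //; exact: le_trans It tt'.
  - rewrite /= spw andbT; apply/allP => I /sab[? ? It] /=.
    by rewrite It orbT.
  - by rewrite big_cons /= (measure_open_segment oU at_ tt' bad) EFinD addeC leeD2r.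
  - rewrite big_cons /=; have := ler_norm (- (h t' - h t)); rewrite normrN.
    have : 0 <= e * (t' - t) by rewrite mulr_ge0 ?subr_ge0// ltW.
    by lra.
suff [s [sab spw slen sh]] : P b.
  have lend : \sum_(I <- s) (I.2 - I.1) < d.
    rewrite -lte_fin; apply: le_lt_trans slen _; apply: le_lt_trans mU.
    apply: le_measure; rewrite ?inE; last exact: subIsetl.
      by apply: measurableI => //; exact: measurable_realfun.open_measurable.
    exact: measurable_realfun.open_measurable.
  have := hd s sab spw lend; rewrite ltr_pdivlMr// => fe.
  have hs : \sum_(I <- s) `|h I.2 - h I.1| <= K * \sum_(I <- s) `|f I.2 - f I.1|.
    rewrite mulr_sumr big_seq [leRHS]big_seq; apply: ler_sum => I /sab[? ? ?].
    by apply: hf; lra.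
  have : 0 <= \sum_(I <- s) `|f I.2 - f I.1| by apply: sumr_ge0.
  by lra.
pose S := [set t | a <= t <= b /\ P t].
have Sa : S a by split=> //; rewrite lexx ab.
have Sub : has_ubound S by exists b => t [/andP[]].
have supS : has_sup S by split; [exists a|].
set c := sup S.
have ac : a <= c by exact: ub_le_sup.
have cb : c <= b by apply: ge_sup => [|t [/andP[]]//]; exists a.
have [r r0 gauge] : exists2 r, 0 < r & forall s, a <= s <= b -> `|c - s| < r ->
   (c <= s -> - (e * (s - c)) <= h s - h c \/ `]c, s] `<=` U) /\
   (s <= c -> - (e * (c - s)) <= h c - h s \/ `]s, c] `<=` U).
  have [Bc|nBc] := pselect (B c).
    have /nbhs_ballP[r /= r0 rU] : nbhs c U.
      by apply: open_nbhs_nbhs; split=> //; apply/B'U/BB'.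
    exists r => // s _; rewrite ltr_norml => /andP[h1 h2]; split=> cs; right=> q /=;
      rewrite in_itv /= => /andP[q1 q2]; apply: rU;
      rewrite -ball_normE /= ltr_norml; lra.
  have cab : a <= c <= b by rewrite ac cb.
  have /nbhs_ballP[r /= r0 rh] := hB c cab nBc e e0.
  exists r => // s sab cs; have [|h1 h2] := rh s _ sab; first by rewrite -ball_normE.
  by split=> [/h1|/h2]; left.
have Pc : P c.
  have [s [sab Ps] cs] := sup_adherent r0 supS.
  have sc : s <= c by apply: ub_le_sup => //; split.
  have scr : `|c - s| < r by rewrite ger0_norm ?subr_ge0//; rewrite -/c in cs; lra.
  have [_ /(_ sc) ok] := gauge s sab scr.
  by apply: step Ps _ sc ok; case/andP: sab.
have [<-//|cb'] := eqVneq c b.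
have cltb : c < b by rewrite lt_neqAle cb' cb.
pose t' := Num.min b (c + r / 2).
have ct' : c < t' by rewrite lt_min cltb ltrDl divr_gt0.
have t'b : a <= t' <= b by rewrite ge_min lexx andbT (le_trans ac)// ltW.
have ct'r : `|c - t'| < r.
  rewrite distrC ger0_norm ?subr_ge0 ?(ltW ct')//.
  have : t' <= c + r / 2 by rewrite ge_min lexx orbT.
  by lra.
have [/(_ (ltW ct')) ok _] := gauge t' t'b ct'r.
have : t' <= c by apply: ub_le_sup => //; split=> //; exact: step Pc ac (ltW ct') ok.
by rewrite leNgt ct'.
Qed.

End AbsoluteContinuity.

(** * Invariance of the safe set *)

Section LocalLipschitz.
Context {R : realType} {N n : nat} (L : 'cV[R]_N -> 'M[R]_n).
Hypothesis LC1 : continuously_differentiable L.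

Lemma compact_norm_ball (r : R) : compact [set z : 'cV[R]_N | `|z| <= r].
Proof.
apply: compact_cV.
  exists r; split; first exact: num_real.
  by move=> x rx z /= zr; exact: le_trans zr (ltW rx).
have -> : [set z : 'cV[R]_N | `|z| <= r] = (fun z => `|z|) @^-1` [set y | y <= r].
  by apply/seteqP; split.
apply: preimage_closed; last exact: closed_le.
by move=> z *; apply: (@cvg_norm _ _ _ (nbhs z)); exact: cvg_id.
Qed.

(** Continuity of each partial derivative bounds it on the compact ball, and the
    partial derivatives bound the differential. *)
Lemma differential_bounded (r : R) : exists2 K : R, 0 <= K &
  forall z v, `|z| <= r -> `|'d L z v| <= K * `|v|.
Proof.
have [dL cL] := LC1.
have /choice[C hC] (i : 'I_N) : exists C, forall z, `|z| <= r ->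
    `|'d L z (delta_mx i 0)| <= C.
  have cLi : {within [set z | `|z| <= r], continuous (fun z => 'd L z (delta_mx i 0))}.
    by apply: continuous_subspaceT; exact: cL.
  have /compact_bounded[M [_ hM]] := continuous_compact cLi (@compact_norm_ball r).
  exists (M + 1) => z zr; apply: (hM (M + 1)); first by rewrite ltrDl.
  by exists z.
exists (\sum_i `|C i|) => [|z v zr]; first exact: sumr_ge0.
have {1}-> : v = \sum_i v i 0 *: delta_mx i 0.
  rewrite [LHS]matrix_sum_delta; apply: eq_bigr => i _.
  by rewrite big_ord_recl big_ord0 addr0.
rewrite linear_sum; apply: le_trans (ler_norm_sum _ _ _) _.
rewrite mulr_suml; apply: ler_sum => i _.
rewrite linearZ /= normrZ mulrC ler_pM//; last exact: coord_le_norm.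
exact: le_trans (hC i z zr) (ler_norm _).
Qed.

Lemma C1_lipschitz_on_balls (r : R) : exists2 K : R, 0 <= K &
  forall y z, `|y| <= r -> `|z| <= r -> `|L y - L z| <= K * `|y - z|.
Proof.
have [K K0 hK] := differential_bounded r; exists K => // y z yr zr.
have [dL _] := LC1.
apply: mx_norm_le => [|i j]; first by rewrite mulr_ge0.
pose p (s : R) := z + s *: (y - z).
have dp s : is_derive s (1 : R) p (y - z).
  have pE : h^-1 *: ((p \o shift s) (h *: (1 : R)) - p s) @[h --> 0^'] --> y - z.
    apply: cvg_near_cst; near=> h.
    have h0 : h != 0 by near: h; exact: nbhs_dnbhs_neq.
    rewrite /p /= [_%:A]mulr1 opprD addrACA subrr add0r -scalerBl addrK.
    by rewrite scalerA mulVf// scale1r.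
  by apply: DeriveDef; [apply/cvg_ex; exists (y - z)|exact: cvg_lim pE].
have df s : is_derive s (1 : R) (fun s => L (p s) i j) ('d L (p s) (y - z) i j).
  have [dLp eLp] := derive_along LC1 (dp s); apply: DeriveDef.
    by move/derivable_mxP: dLp => /(_ i j).
  by rewrite -(state_derivativeE LC1) -eLp derive_mx// mxE.
have cf : {within `[0, 1], continuous (fun s => L (p s) i j)}.
  apply: continuous_subspaceT => u; apply: differentiable_continuous.
  by apply/derivable1_diffP; case: (df u).
have [s s01] := @MVT R _ _ 0 1 ltr01 (fun s _ => df s) cf.
have p1 : p 1 = y by rewrite /p scale1r addrC subrK.
have p0 : p 0 = z by rewrite /p scale0r addr0.
rewrite p1 p0 subr0 mulr1 => e.
have -> : (L y - L z) i j = L y i j - L z i j by rewrite !mxE.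
rewrite e; apply: le_trans (coord_le_norm _ _ _) _; apply: hK.
move: s01; rewrite in_itv /= => /andP[s0 s1].
have -> : p s = (1 - s) *: z + s *: y.
  by rewrite /p; apply/colP => l; rewrite !mxE; ring.
apply: le_trans (ler_normD _ _) _; rewrite !normrZ (gtr0_norm s0) gtr0_norm ?subr_gt0//.
have : s * `|y| <= s * r by rewrite ler_wpM2l// ltW.
have : (1 - s) * `|z| <= (1 - s) * r by rewrite ler_wpM2l// subr_ge0 ltW.
lra.
Unshelve. all: by end_near. Qed.

End LocalLipschitz.

Section DerivativeNear.
Context {R : realType}.

Lemma is_derive_near (V : normedModType R) (f : R -> V) (t : R) (w : V) :
  is_derive t (1 : R) f w -> forall e, 0 < e ->
  \forall s \near t, `|f s - f t - (s - t) *: w| <= e * `|s - t|.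
Proof.
move=> [df <-] e e0; have := df => /cvgrPdist_le /(_ e e0) [r /= r0 hr].
apply/nbhs_ballP; exists r => // s; rewrite -ball_normE /= => tsr.
have [->|st] := eqVneq s t; first by rewrite !subrr scale0r subrr !normr0 mulr0.
have h0 : s - t != 0 by rewrite subr_eq0.
have := hr (s - t); rewrite /= sub0r normrN distrC => /(_ tsr h0).
rewrite /shift /= [_%:A]mulr1 subrK -/('D_1 f t) distrC => h.
have -> : f s - f t - (s - t) *: 'D_1 f t =
    (s - t) *: ((s - t)^-1 *: (f s - f t) - 'D_1 f t).
  by rewrite scalerBr scalerA divff// scale1r.
by rewrite normrZ mulrC ler_wpM2r// distrC.
Qed.

(** If h t1 < c, then after the last time t0 with c <= h t0 the function stays below
    c, and shortly after t0 it is still positive, hence nondecreasing there, which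
    contradicts continuity at t0. The positivity in the monotonicity hypothesis is what
    restricts the argument to a neighbourhood of t0. *)
Lemma barrier_stays_above (h : R -> R) (t1 c : R) : 0 <= t1 -> 0 < c -> c <= h 0 ->
  (forall e : R, 0 < e -> exists2 d : R, 0 < d &
     forall s t, 0 <= s <= t1 -> 0 <= t <= t1 ->
     `|s - t| < d -> `|h s - h t| < e) ->
  (forall a b, 0 <= a -> a <= b -> b <= t1 ->
     (forall t, a <= t <= b -> 0 < h t <= c) -> h a <= h b) ->
  c <= h t1.
Proof.
move=> t1_ge0 c0 hc0 uc mono; rewrite leNgt; apply/negP => ht1.
pose S := [set t | 0 <= t <= t1 /\ c <= h t].
have S0 : S 0 by split=> //; rewrite lexx.
have supS : has_sup S by split; [exists 0|exists t1 => t [/andP[]]].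
set t0 := sup S.
have t00 : 0 <= t0 by apply: ub_le_sup => //; case: supS.
have t01 : t0 <= t1 by apply: ge_sup => [|t [/andP[]]//]; exists 0.
have ht0 : c <= h t0.
  rewrite leNgt; apply/negP => hlt.
  have c_t0 : 0 < c - h t0 by rewrite subr_gt0.
  have [d d0 hd] := uc _ c_t0.
  have [s [sab cs] ts] := sup_adherent d0 supS; rewrite -/t0 in ts.
  have st0 : s <= t0 by apply: ub_le_sup; [case: supS|split].
  have := hd s t0 sab; rewrite t00 t01 => /(_ isT).
  have std : `|s - t0| < d by rewrite distrC ger0_norm ?subr_ge0//; lra.
  by move=> /(_ std); rewrite ltr_norml => /andP[_]; lra.
have above t : t0 < t -> t <= t1 -> h t < c.
  move=> tt tt1; rewrite ltNge; apply/negP => ch.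
  have : t <= t0.
    by apply: ub_le_sup; [case: supS|split=> //; rewrite tt1 (le_trans t00)// ltW].
  by rewrite leNgt tt.
have t0t1 : t0 < t1.
  rewrite lt_neqAle t01 andbT; apply/eqP => e.
  by move: ht1; rewrite -e ltNge ht0.
have [d d0 hd] := uc c c0.
pose b := Num.min t1 (t0 + d / 2).
have t0b : t0 < b by rewrite lt_min t0t1 ltrDl divr_gt0.
have bt1 : b <= t1 by rewrite ge_min lexx.
have bd : b <= t0 + d / 2 by rewrite ge_min lexx orbT.
have pos t : t0 < t -> t <= b -> 0 < h t <= c.
  move=> tt tb; rewrite ltW ?above ?(le_trans tb)// andbT.
  have := hd t t0; rewrite t00 t01 (le_trans tb bt1) (le_trans t00 (ltW tt)).
  move=> /(_ isT isT); rewrite gtr0_norm ?subr_gt0//.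
  have td : t - t0 < d by lra.
  by move=> /(_ td); rewrite ltr_norml => /andP[]; lra.
have hb : h b < c by apply: above.
have c_b : 0 < c - h b by rewrite subr_gt0.
have [d' d'0 hd'] := uc _ c_b.
pose a := Num.min b (t0 + d' / 2).
have t0a : t0 < a by rewrite lt_min t0b ltrDl divr_gt0.
have ab : a <= b by rewrite ge_min lexx.
have ad : a <= t0 + d' / 2 by rewrite ge_min lexx orbT.
have : h a <= h b.
  apply: mono => // [|t /andP[ta tb]]; first by rewrite (le_trans t00)// ltW.
  by apply: pos => //; exact: lt_le_trans t0a ta.
have := hd' a t0; rewrite t00 t01 (le_trans ab bt1) (le_trans t00 (ltW t0a)).
move=> /(_ isT isT); rewrite gtr0_norm ?subr_gt0//.
have td : a - t0 < d' by lra.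
by move=> /(_ td); rewrite ltr_norml => /andP[]; lra.
Qed.

End DerivativeNear.

Section Invariance.
Context {R : realType} {N n : nat} (A : 'cV[R]_N -> 'M[R]_n).
Hypothesis hn : (2 <= n)%N.
Hypothesis Asym : forall x, (A x)^T = A x.
Hypothesis AC1 : continuously_differentiable A.
Let L x := laplacian (A x).
Let LC1 : continuously_differentiable L.
Proof. exact: laplacian_C1. Qed.
Let Lsym x : (L x)^T = L x.
Proof. exact: laplacian_sym. Qed.

(** For s >= t take a unit eigenvector v of lambda_2(M s), for s <= t one of
    lambda_2(M t). It is orthogonal to the constants, so the Rayleigh quotient of the
    other matrix at v bounds the other eigenvalue from above, and the increment of
    lambda_2 from the earlier to the later time is at least that of v^T M v, which
    is |s - t| v^T B v to first order. The bound v^T B v >= 0 holds on the eigenspace of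
    lambda_2(M t), and up to e / 2 on the eigenvectors at times s near t. The
    estimates are one-sided because lambda_2 need not be differentiable where it is
    a multiple eigenvalue. *)
Lemma lambda2_lower_derivative (x : R -> 'cV[R]_N) (t : R) (w : 'cV[R]_N) :
  is_derive t (1 : R) x w -> 0 < lambda (L (x t)) 2 ->
  0 <= mu L (nat_range 2 2) (x t) w ->
  forall e : R, 0 < e -> \forall s \near t,
    (t <= s -> - (e * (s - t)) <= lambda (L (x s)) 2 - lambda (L (x t)) 2) /\
    (s <= t -> - (e * (t - s)) <= lambda (L (x t)) 2 - lambda (L (x s)) 2).
Proof.
move=> dx l2 mu0 e e0; have n2 : (2 <= 2 <= n)%N by [].
pose M s := L (x s); pose B := state_derivative L (x t) w.
have dM : is_derive t (1 : R) M B by exact: derive_along.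
have cM : M s @[s --> t] --> M t.
  by apply: differentiable_continuous; apply/derivable1_diffP; case: dM.
have e20 : 0 < e / 2 by rewrite divr_gt0.
have eta0 : 0 < e / 2 / n%:R by rewrite divr_gt0// ltr0n; lia.
have lpos : \forall s \near t, 0 < lambda (M s) 2.
  have : lambda (M s) 2 @[s --> t] --> lambda (M t) 2.
    by apply: cvg_lambda; [move=> s; exact: Lsym|exact: Lsym|lia|exact: cM].
  by move=> /cvgr_gt/(_ 0)/(_ l2).
(* eigenvectors of lambda_2 (M s) accumulate only at those of lambda_2 (M t) *)
have qnear : \forall s \near t, [set v | sqnorm v = 1] `<=` [set v |
    M s *m v = lambda (M s) 2 *: v -> - (e / 2) <= qform B v].
  have /compact_near_coveringP cov := @compact_sphere R n.
  apply: (cov R (nbhs t) (fun s v =>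
    M s *m v = lambda (M s) 2 *: v -> - (e / 2) <= qform B v)) => v v1.
  have [qv|qv] := eqVneq (spec_prod (M t) [:: 2] v) 0.
    have : qform B u.1 @[u --> filter_prod (nbhs v) (nbhs t)] --> qform B v.
      by apply: cvg_qform; [exact: cvg_cst|exact: cvg_fst].
    have Bv : 0 <= qform B v.
      by have /(mu_geP _ _ (Lsym (x t)) n2) := mu0; apply.
    move=> /cvgr_gt/(_ (- (e / 2)))/(_ _)[|V Vn VP]; first by lra.
    by exists V => // u /VP /= /ltW.
  have : sqnorm (spec_prod (M u.2) [:: 2] u.1) @[u --> filter_prod (nbhs v) (nbhs t)]
      --> sqnorm (spec_prod (M t) [:: 2] v).
    apply: cvg_sqnorm; apply: cvg_spec_prod.
    - by move=> u; exact: Lsym.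
    - exact: Lsym.
    - by rewrite /= hn.
    - exact: (@cvg_comp _ _ _ snd M _ (nbhs t) _ cvg_snd cM).
    - exact: cvg_fst.
  move=> /cvgr_gt/(_ 0)/(_ (sqnorm_gt0 qv))[V Vn VP].
  exists V => // u /VP /= h Mu; move: h; rewrite Mu subrr /sqnorm big1 ?ltxx// => i _.
  by rewrite mxE expr0n.
have dnear := is_derive_near dM eta0.
near=> s.
have ls : 0 < lambda (M s) 2 by near: s.
have hq : [set v | sqnorm v = 1] `<=` [set v |
    M s *m v = lambda (M s) 2 *: v -> - (e / 2) <= qform B v] by near: s.
have hd : `|M s - M t - (s - t) *: B| <= e / 2 / n%:R * `|s - t| by near: s.
have qd (v : 'cV[R]_n) : sqnorm v = 1 ->
    `|qform (M s) v - qform (M t) v - (s - t) * qform B v| <= e / 2 * `|s - t|.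
  move=> v1; rewrite -qformB -qformZl -qformB.
  apply: le_trans (qform_le_norm _ _) _; rewrite v1 mulr1.
  have n0 : (0 : R) < n%:R by rewrite ltr0n; lia.
  apply: le_trans (ler_wpM2l (ltW n0) hd) _.
  by rewrite mulrA [n%:R * _]mulrC divfK// gt_eqF.
have eigq u (v : 'cV[R]_n) : sqnorm v = 1 -> M u *m v = lambda (M u) 2 *: v ->
    qform (M u) v = lambda (M u) 2.
  move=> v1 Mv; rewrite /qform -mulmxA Mv -scalemxAr mxE -sqnormE v1.
  by rewrite mulr1.
split=> st.
  have [v [v1 Mv v0]] := laplacian_fiedler hn (Asym (x s)) ls.
  have Bv := hq v v1 Mv.
  have hR : lambda (M t) 2 * sqnorm v <= qform (M t) v.
    exact: (@laplacian_rayleigh R n hn (A (x t)) v (Asym (x t)) l2 v0).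
  have std : `|s - t| = s - t by rewrite ger0_norm ?subr_ge0.
  have := qd v v1; rewrite (eigq s v v1 Mv) std ler_norml => /andP[h1 _].
  have : - (e / 2) * (s - t) <= (s - t) * qform B v.
    by rewrite mulrC ler_wpM2l// subr_ge0.
  by rewrite v1 mulr1 in hR; rewrite -/(M s) -/(M t); lra.
have [v [v1 Mv v0]] := laplacian_fiedler hn (Asym (x t)) l2.
have Bv : 0 <= qform B v.
  have /(mu_geP _ _ (Lsym (x t)) n2) := mu0; apply=> //=.
  by rewrite Mv subrr.
have hR : lambda (M s) 2 * sqnorm v <= qform (M s) v.
  exact: (@laplacian_rayleigh R n hn (A (x s)) v (Asym (x s)) ls v0).
have std : `|s - t| = t - s by rewrite distrC ger0_norm ?subr_ge0.
have := qd v v1; rewrite (eigq t v v1 Mv) std ler_norml => /andP[_ h2].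
have : 0 <= e / 2 * (t - s) by rewrite mulr_ge0 ?subr_ge0// ltW.
have : 0 <= (t - s) * qform B v by rewrite mulr_ge0// subr_ge0.
by rewrite v1 mulr1 in hR; rewrite -/(M s) -/(M t); lra.
Unshelve. all: by end_near. Qed.

Variables (alpha : R -> R) (eps : R).
Hypothesis alpha_K : extended_class_K alpha.
Hypothesis eps0 : 0 < eps.
Variable k : 'cV[R]_N -> 'cV[R]_N.
Hypothesis k_feasible : forall x, U_range L alpha eps 2 x (k x).

Lemma trajectory_invariance (T : set R) (x : R -> 'cV[R]_N) :
  C_set L eps (x 0) -> is_interval T -> T 0 ->
  caratheodory_solution k T x ->
  forall t, T t -> 0 <= t -> eps <= lambda (L (x t)) 2.
Proof.
move=> x0 iT T0 [acx /= [B' [mB' B'0 hB']]] t1 Tt1 t1_ge0.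
have sub t : 0 <= t <= t1 -> T t by exact: iT.
have ac01 : absolutely_continuous 0 t1 x by exact: acx.
have [r _ hr] := ac_bounded ac01.
have [K K0 hK] := C1_lipschitz_on_balls LC1 r.
pose h t := lambda (L (x t)) 2.
have hlip s t : 0 <= s <= t1 -> 0 <= t <= t1 ->
    `|h s - h t| <= n%:R * K * `|x s - x t|.
  move=> sab tab.
  apply: le_trans (lambda_lipschitz (Ordinal hn) (Lsym (x s)) (Lsym (x t))) _.
  by rewrite -mulrA ler_wpM2l// hK// hr.
have nK0 : 0 <= n%:R * K by rewrite mulr_ge0.
apply: (@barrier_stays_above R h) => //.
  move=> e e0; have nK1 : 0 < n%:R * K + 1 by rewrite ltr_wpDl.
  have [d d0 hd] := ac_uniformly_continuous ac01 (divr_gt0 e0 nK1).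
  exists d => // s t sab tab std; have := hd s t sab tab std.
  rewrite ltr_pdivlMr// => xe; apply: le_lt_trans (hlip s t sab tab) _.
  by apply: le_lt_trans xe; rewrite mulrC ler_wpM2l// lerDl.
move=> a b a0 ab bt1 hab.
apply: (ac_nondecreasing (f := x) (K := n%:R * K) (B := B')) => //.
- by apply: acx; apply: sub; lra.
- by move=> s t sab tab; apply: hlip; lra.
- by exists B'; split.
move=> t tab nB't e e0.
have Tt : T t by apply: sub; lra.
have dx : is_derive t (1 : R) x (k (x t)).
  by apply: contrapT => nd; apply: nB't; apply: hB' => /(_ Tt).
have /andP[ht0 hte] := hab t tab.
have mu0 : 0 <= mu L (nat_range 2 2) (x t) (k (x t)).
  apply: le_trans (k_feasible (x t)).
  rewrite oppr_ge0; case: alpha_K => _ amono a0'; rewrite -a0'.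
  have : lambda (L (x t)) 2 - eps <= 0 by rewrite subr_le0.
  by rewrite le_eqVlt => /predU1P[->|/amono/ltW].
have := lambda2_lower_derivative dx ht0 mu0 e0.
by apply: filterS => s hs _.
Qed.

End Invariance.

(** * Continuity and forward invariance *)

Unset Implicit Arguments.

Theorem theorem5p2 (R : realType) (n : nat) (hn : (2 <= n)%N)
  (d : 'I_n -> nat) (N : nat) (hN : N = (\sum_(r < n) d r)%N)
  (A : 'cV[R]_N -> 'M[R]_n)
  (hAsym : forall x, (A x)^T = A x)
  (hAge0 : forall x i j, 0 <= A x i j)
  (hAC1 : continuously_differentiable A)
  (L : 'cV[R]_N -> 'M[R]_n) (hL : L = fun x => laplacian (A x))
  (alpha : R -> R) (halpha : extended_class_K alpha)
  (halphaLip : locally_lipschitz alpha)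
  (eps : R) (heps : 0 < eps)
  (J : 'cV[R]_N -> 'cV[R]_N -> R)
  (hJcont : continuous (fun z : 'cV[R]_N * 'cV[R]_N => J z.1 z.2))
  (hJconv : forall x, strictly_convex (J x))
  (dnom : nat) (g : 'cV[R]_N -> 'cV[R]_N -> 'cV[R]_dnom)
  (hgcont : continuous (fun z : 'cV[R]_N * 'cV[R]_N => g z.1 z.2))
  (hgconv : forall x i, convex_function setT (fun u => g x u i 0))
  (hstrict : forall x, exists u,
     (forall m, (2 <= m <= n)%N ->
        - alpha (lambda (L x) m - eps) < mu L (nat_range 2 m) x u) /\
     (forall i, g x u i 0 < 0))
  (k : 'cV[R]_N -> 'cV[R]_N)
  (hk : forall x, argmin (J x) (U_agg L alpha eps x `&` U_nom g x) (k x)) :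
  {within C_set L eps, continuous k} /\
  (forall (x0 : 'cV[R]_N) (T : set R) (x : R -> 'cV[R]_N),
     C_set L eps x0 ->
     is_interval T -> T 0 -> T `<=` [set t | 0 <= t] ->
     caratheodory_solution k T x -> x 0 = x0 ->
     forall t, T t -> eps <= lambda (L (x t)) 2 /\ graph_connected (A (x t))).
Proof.
subst L; set L := fun x => laplacian (A x).
have LC1 : continuously_differentiable L by exact: laplacian_C1.
have Lsym x : (L x)^T = L x by exact: laplacian_sym.
have L1_le0 x : lambda (L x) 1 <= 0 by exact: lambda1_laplacian_le0.
have alpha_continuous : continuous alpha by case: halpha.
split.
  by apply: (@controller_continuous R N n dnom L alpha eps J g k) => //.
move=> x0 T x x0C iT T0 Tge0 sol xx0 t Tt.
have l2 : eps <= lambda (L (x t)) 2.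
  apply: (trajectory_invariance hn hAsym hAC1 halpha heps (k := k) _ _ iT T0 sol Tt).
  - move=> y; have [[Uy _] _] := hk y.
    by apply: (Uy 2); rewrite /nat_range /= hn.
  - by rewrite xx0.
  - exact: Tge0.
split=> //; apply: (laplacian_connected hn) => //; exact: lt_le_trans heps l2.
Qed.
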